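(* Let $z^*\in[k]^n$ and let $X_1,\dots,X_n\in\mathbb R^d$ be generated from the Laplace mixture model $$X_{i\ell}=\mu_{z_i^*\ell}+\sigma_{z_i^*\ell}\,\epsilon_{i\ell},\qquad i\in[n],\ \ell\in[d],$$ where the $\epsilon_{i\ell}$ are independent standard Laplace variables $\mathrm{Lap}(0,1)$, $\mu_a\in\mathbb R^d$ (possibly depending on $n$), and $\sigma_a\in(0,\infty)^d$ with entries that are constants not depending on $n$, for $a\in[k]$. Let $\mathcal F=(f_1,\dots,f_k)$ where $f_a$ is the density of $X_i$ when $z^*_i=a$. Suppose that $k\log^2(dk)=o(n)$ and $\min_{a\in[k]}\sum_{i\in[n]}\mathbf 1\{z_i^*=a\}\ge\alpha nk^{-1}$ for some $\alpha>0$ independent of $n$. Assume that $$\Delta_{\mu,\infty}=O\left(d^{-1}\mathrm{Chernoff}(\mathcal F)\right)\quad\text{and}\quad \mathrm{Chernoff}(\mathcal F)=\omega\left(d\sqrt k\left(1+\frac{\Delta_{\mu,\infty}}{\sqrt{nk^{-1}}}\right)\right),$$ where $\Delta_{\mu,\infty}=\max_{a\ne b\in[k]}\|\mu_a-\mu_b\|_\infty$. Let $\hat z^{(t)}$ be the output after $t$ steps of the iterative algorithm described in the context, and suppose that its initialization satisfies $\mathrm{loss}(z^*,\hat z^{(0)})=o\left(nk^{-1}\Delta_{\mu,\infty}^{-1}\right)$. Then, for any arbitrary constant $c>0$, with probability at least $1-o(1)$, $$n^{-1}\,\mathrm{loss}\left(z^*,\hat z^{(t)}\right)\le e^{-(1+o(1))\,\mathrm{Chernoff}(\mathcal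 F)}\qquad\forall t\ge\lfloor c\log n\rfloor .$$
   Context: $[k]=\{1,\dots,k\}$; asymptotic notation is for $n\to\infty$ ($a=\omega(b)$ means $b=o(a)$), and $e^{-(1+o(1))C_n}$ means $e^{-(1+\epsilon_n)C_n}$ with $\epsilon_n\to0$. $\mathrm{Lap}(\mu,\sigma)$ has density $\frac1{2\sigma}e^{-|x-\mu|/\sigma}$ on $\mathbb R$; thus $f_a(x)=\prod_{\ell=1}^d\frac1{2\sigma_{a\ell}}e^{-|x_\ell-\mu_{a\ell}|/\sigma_{a\ell}}$. $\mathrm{Chernoff}(f,g)=-\log\inf_{t\in(0,1)}\int f^t(x)g^{1-t}(x)\,dx$ and $\mathrm{Chernoff}(\mathcal F)=\min_{1\le a\ne b\le k}\mathrm{Chernoff}(f_a,f_b)$. $\mathrm{loss}(z,\hat z)=\min_{\tau\in \mathrm{Sym}(k)}\mathrm{Ham}(z,\tau\circ\hat z)$, with $\mathrm{Sym}(k)$ the permutations of $[k]$ and $\mathrm{Ham}$ the Hamming distance. Algorithm (given the data, $k$, and an initial clustering $\hat z^{(0)}\in[k]^n$): for $t=1,2,\dots$, (1) for each $a\in[k]$, $\ell\in[d]$, with $\Gamma_a=\{i\in[n]:\hat z_i^{(t-1)}=a\}$, set $\hat\mu^{(t)}_{a\ell}=|\Gamma_a|^{-1}\sum_{i\in\Gamma_a}X_{i\ell}$ and $\hat\sigma^{(t)}_{a\ell}=|\Gamma_a|^{-1}\sum_{i\in\Gamma_a}|X_{i\ell}-\hat\mu^{(t)}_{a\ell}|$;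 (2) for each $i\in[n]$, set $\hat z_i^{(t)}=\arg\max_{a\in[k]}\sum_{\ell=1}^d\left(-\log \hat\sigma_{a\ell}^{(t)}-\frac{|X_{i\ell}-\hat\mu_{a\ell}^{(t)}|}{\hat\sigma_{a\ell}^{(t)}}\right)$, i.e. the label maximizing the estimated Laplace log-likelihood. *)

(* Defs.v *)
From HB Require Import structures.
From mathcomp Require Import all_boot all_order all_algebra all_fingroup.
From mathcomp Require Import all_classical all_reals all_analysis.

Set Implicit Arguments.
Unset Strict Implicit.
Unset Printing Implicit Defensive.

Import Order.TTheory GRing.Theory Num.Theory.
Import numFieldNormedType.Exports.

Local Open Scope classical_set_scope.
Local Open Scope ring_scope.

Section lebesgue_measure_Rd.
Context {R : realType}.

Definition tcons (d : nat) (x : measurableTypeR R * d.-tuple R) :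
  d.+1.-tuple R := [tuple of (x.1 : R) :: x.2].

Lemma measurable_tcons d : measurable_fun setT (@tcons d).
Proof. exact: (measurable_cons measurable_fst measurable_snd). Qed.

Section lebesgue_measure_cons.
Variables (d : nat) (m : {sigma_finite_measure set (d.-tuple R) -> \bar R}).

Definition lebesgue_measure_cons : set (d.+1.-tuple R) -> \bar R :=
  pushforward (@lebesgue_measure R \x m)%E (@tcons d).

Let pf : {measure set (d.+1.-tuple R) -> \bar R} :=
  measure_function_pushforward__canonical__measure_function_Measure
    (@lebesgue_measure R \x m)%E (@measurable_tcons d).

Let lebesgue_measure_cons0 : lebesgue_measure_cons set0 = 0%E.
Proof. exact: (measure0 pf). Qed.

Let lebesgue_measure_cons_ge0 A : (0 <= lebesgue_measure_cons A)%E.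
Proof. exact: (measure_ge0 pf). Qed.

Let lebesgue_measure_cons_sigma_additive :
  semi_sigma_additive lebesgue_measure_cons.
Proof. exact: (@measure_semi_sigma_additive _ _ _ pf). Qed.

HB.instance Definition _ := isMeasure.Build _ _ _ lebesgue_measure_cons
  lebesgue_measure_cons0 lebesgue_measure_cons_ge0
  lebesgue_measure_cons_sigma_additive.

Let lebesgue_measure_cons_sigma_finite : sigma_finite setT lebesgue_measure_cons.
Proof.
have /sigma_finiteP[F [FT Fnd Foo]] := sigma_finiteT (@lebesgue_measure R).
have /sigma_finiteP[G [GT Gnd Goo]] := sigma_finiteT m.
pose g (v : d.+1.-tuple R) : measurableTypeR R * d.-tuple R :=
  (thead v, [tuple of behead v]).
have gK : cancel (@tcons d) g.
  by move=> [x v]; rewrite /g /tcons/= theadE; congr pair; exact: val_inj.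
have mg : measurable_fun setT g.
  apply: measurable_fun_pair; last exact: measurable_behead.
  exact: measurable_tnth.
exists (fun n => g @^-1` (F n `*` G n)).
  rewrite -preimage_bigcup; apply/esym/seteqP; split => // v _.
  have : [set: measurableTypeR R] (g v).1 by [].
  have : [set: d.-tuple R] (g v).2 by [].
  rewrite {1}GT {1}FT => -[j _ Gj] [i _ Fi]; exists (maxn i j) => //; split.
  - by move: Fi; exact/subsetPset/Fnd/leq_maxl.
  - by move: Gj; exact/subsetPset/Gnd/leq_maxr.
move=> n; have [mF Fn] := Foo n; have [mG Gn] := Goo n; split.
  by rewrite -[_ @^-1` _]setTI; apply: mg => //; exact: measurableX.
rewrite /lebesgue_measure_cons /pushforward -comp_preimage.
rewrite (_ : g \o _ = id); last by apply/funext => x /=; exact: gK.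
by rewrite preimage_id product_measure1E// lte_mul_pinfty// ge0_fin_numE.
Qed.

HB.instance Definition _ := Measure_isSigmaFinite.Build _ _ _
  lebesgue_measure_cons lebesgue_measure_cons_sigma_finite.

End lebesgue_measure_cons.

(* The Lebesgue measure on R^d, as the d-fold product of [lebesgue_measure];
   vectors of R^d are d-tuples, with the product sigma-algebra. *)
Fixpoint lebesgue_measure_Rd (d : nat) :
    {sigma_finite_measure set (d.-tuple R) -> \bar R} :=
  if d is d'.+1 then lebesgue_measure_cons (lebesgue_measure_Rd d')
  else dirac [tuple].

End lebesgue_measure_Rd.

Section densities.
Context {R : realType}.

Definition laplace_pdf (m s x : R) : R := (2 * s)^-1 * expR (- (`|x - m| / s)).

Definition laplace_density (d : nat) (mu sigma : 'I_d -> R) (x : d.-tuple R) : R :=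
  \prod_(l < d) laplace_pdf (mu l) (sigma l) (tnth x l).

Local Open Scope ereal_scope.

(* [lne 0 = -oo]: densities with disjoint supports have divergence [+oo]. *)
Definition chernoff (d : nat) (f g : d.-tuple R -> R) : \bar R :=
  - lne (ereal_inf [set \int[lebesgue_measure_Rd d]_x
                          (f x `^ t * g x `^ (1 - t))%:E | t in `]0%R, 1%R[]).

Definition chernoff_family (d k : nat) (f : 'I_k -> d.-tuple R -> R) : \bar R :=
  \big[mine/+oo]_(p : 'I_k * 'I_k | p.1 != p.2) chernoff (f p.1) (f p.2).

End densities.

Definition separation_inf (R : realType) (d k : nat) (mu : 'I_k -> 'I_d -> R) : R :=
  \big[Num.max/0]_(p : 'I_k * 'I_k | p.1 != p.2)
    \big[Num.max/0]_(l < d) `|mu p.1 l - mu p.2 l|.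

Section clustering.
Variables (n k : nat).

Definition hamming (z z' : {ffun 'I_n -> 'I_k}) : nat := #|[set i | z i != z' i]|.

(* The default value [n] is harmless: Hamming distances are at most [n]. *)
Definition loss (z z' : {ffun 'I_n -> 'I_k}) : nat :=
  \big[minn/n]_(tau : {perm 'I_k}) hamming z [ffun i => tau (z' i)].

Definition label_class (z : {ffun 'I_n -> 'I_k}) (a : 'I_k) : {set 'I_n} :=
  [set i | z i == a].

End clustering.

Section algorithm.
Context {R : realType} (n d k : nat).
Implicit Types (X : 'I_n -> 'I_d -> R) (z : {ffun 'I_n -> 'I_k}).

Definition mu_hat X z (a : 'I_k) (l : 'I_d) : R :=
  #|label_class z a|%:R^-1 * \sum_(i in label_class z a) X i l.

Definition sigma_hat X z (a : 'I_k) (l : 'I_d) : R :=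
  #|label_class z a|%:R^-1 * \sum_(i in label_class z a) `|X i l - mu_hat X z a l|.

(* Degenerate estimates (an empty cluster, or a zero scale) are evaluated with
   the conventions [0^-1 = 0] and [ln 0 = 0]. *)
Definition laplace_score X z (i : 'I_n) (a : 'I_k) : R :=
  \sum_(l < d) (- ln (sigma_hat X z a l)
                - `|X i l - mu_hat X z a l| / sigma_hat X z a l).

(* [zhat t] is the clustering after [t] steps, started from [zhat 0]; ties in
   the arg max may be broken in any way. *)
Definition iterates X (zhat : nat -> {ffun 'I_n -> 'I_k}) : Prop :=
  forall t i b,
    laplace_score X (zhat t) i b <= laplace_score X (zhat t) i (zhat t.+1 i).

End algorithm.

Section probability.
Context {R : realType}.

Definition mutually_independent d (T : measurableType d) (P : probability T R)
    (I : finType) (Y : I -> {RV P >-> R}) : Prop :=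
  forall (J : {set I}) (B : I -> set R), (forall i, measurable (B i)) ->
    P (\bigcap_(i in [set` J]) (Y i @^-1` B i)) =
    (\prod_(i in J) P (Y i @^-1` B i))%E.

Definition has_density d (T : measurableType d) (P : probability T R)
    (Y : {RV P >-> R}) (f : R -> R) : Prop :=
  forall B : set R, measurable B ->
    distribution P Y B = (\int[lebesgue_measure]_(x in B) (f x)%:E)%E.

(* The event [Q n] of the n-th probability space occurs with probability at
   least 1 - o(1); as [Q n] need not be measurable, this is asked of a
   measurable event included in it. *)
Definition with_high_probability (disp : nat -> measure_display)
    (T : forall n, measurableType (disp n)) (P : forall n, probability (T n) R)
    (Q : forall n, set (T n)) : Prop :=
  exists E : forall n, set (T n),
    [/\ forall n, measurable (E n), forall n, E n `<=` Q n &
        P n (E n) @[n --> \oo] --> 1%:E].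

End probability.

(* Main.v *)
Require Import Defs.
From HB Require Import structures.
From mathcomp Require Import all_boot all_order all_algebra all_fingroup.
From mathcomp Require Import all_classical all_reals all_analysis.
From mathcomp Require Import measurable_realfun.
From mathcomp Require Import ring lra.

Set Implicit Arguments.
Unset Strict Implicit.
Unset Printing Implicit Defensive.

Import Order.TTheory GRing.Theory Num.Theory.
Import numFieldNormedType.Exports.

Local Open Scope classical_set_scope.
Local Open Scope ring_scope.

(** The algorithm reaches the optimal rate in one step, as soon as the labelling
it starts from lies in a neighbourhood of the truth, and then it stays there.

Write [C] for the Chernoff divergence of the mixture, [Delta] for the separation
and [nu = n / k]. Fix a small [eta], and let [z] be a labelling that, after a
permutation of the labels, is wrong on at most [eta * nu / Delta] points. A
misplaced point changes the sum over a cluster by at most [Delta] plus its own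
noise; the terms [Delta] add up to at most [eta * nu]. The set of misplaced points
depends on the data, but the noise it carries can be bounded for all such sets at
once: [|x| <= Delta + max (|x| - Delta) 0], and the sum of the excesses [max (|x|
- Delta) 0] over all the points is at most [eta * nu] because [k * exp (- Delta /
2)] tends to 0. Hence the estimated centres and scales are within [O(eta)] of the
true ones ([mu_hat_close], [sigma_hat_close]), and the estimated log-likelihood of
a point is within [O(eta) (d * Delta + sum_l |eps_l|)] of the true one
([score_close]). Since [d * Delta = O(C)], a point can be mislabelled at the next
step only if its noise is larger than [4 * C], or if its true log-likelihood ratio
in favour of some wrong class exceeds [- rho * C], with [rho] as small as wanted
([mistakes_confused]). The set [confused] of these points does not depend on [z],
which is why no independence between the data and the labelling is needed.

For a product of Laplace laws the exponential moment of order [t] of the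
log-likelihood ratio of class [b] against the true class [a] is the integral
defining the Chernoff divergence ([likelihood_ratio_mgf]), so that for a suitable
[t] in (0, 1) a point is confused with probability at most [exp (- C) + k * exp (1
+ rho * C - C)]. By Markov's inequality there are at most [n * exp (- (1 - 4 *
rho) * C)] confused points with probability tending to 1 ([confusion_event]). This
number is eventually below [eta * nu / Delta], because [k * Delta * exp (- C / 2)]
tends to 0 ([contraction_rate]). The new labelling is therefore in the
neighbourhood again, and induction on the step gives the bound at every positive
step ([recovery_event]).

Each noise bound holds on an event where finitely many nonnegative variables with
small total expectation are at most 1 ([markov_family]). These variables are
exponentials of sums of independent variables, whose expectations factorise
([integral_prod_independent]).

Finally [C <= d * (Delta / smin + ln (smax / smin))] ([chernoff_family_laplace]),
so that [C = omega(d * sqrt k)] makes [Delta / sqrt k] tend to infinity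
([separation_large]); together with [k * ln (d * k) ^ 2 = o(n)] this makes every
failure probability vanish ([failure_bound_vanishes]). The argument is run with
the exponent [(1 - r) * C] for a fixed [r > 0], and [vanishing_precision] lets [r]
tend to 0 with [n]. *)

(** * Integrals of compositions against a weight *)

Section change_of_variables.
Local Open Scope ereal_scope.
Context {R : realType}.
Import HBNNSimple.

(** The absolute value makes every coefficient nonnegative, so that integrals
can be exchanged with the sum without knowing that [r] is a value of [g]. *)
Lemma nnsfun_sum_indic d (T : measurableType d) (g : {nnsfun T >-> R}) :
  exists s : seq R, forall x,
    g x = (\sum_(r <- s) `|r| * \1_(g @^-1` [set r]) x)%R.
Proof.
have [s Es] : exists s : seq R, forall x,
    g x = (\sum_(r <- s) r * \1_(g @^-1` [set r]) x)%R.
  exists (finmap.enum_fset (fset_set (range g))) => x.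
  by rewrite [LHS]fimfunE fsbig_finite.
exists s => x; rewrite Es; apply: eq_bigr => r _.
rewrite indicE; case: (boolP (x \in _)); rewrite ?mulr0// inE /= => gx.
by rewrite ger0_norm// -gx.
Qed.

(** A measure is determined by its values on sets: the hypothesis says that the
images under [phi1] and [phi2] of the measures of densities [h1] and [h2] agree.
The equality passes from indicators to simple functions by linearity and to [g]
by monotone convergence. With [h] the product of the remaining factors it serves
to factor an expectation; with [h] a density it computes an expectation. *)
Lemma ge0_integral_comp_weight d1 d2 d (T1 : measurableType d1)
    (T2 : measurableType d2) (T : measurableType d)
    (m1 : {measure set T1 -> \bar R}) (m2 : {measure set T2 -> \bar R})
    (phi1 : T1 -> T) (phi2 : T2 -> T) (h1 : T1 -> R) (h2 : T2 -> R)
    (g : T -> R) :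
  measurable_fun setT phi1 -> measurable_fun setT phi2 ->
  measurable_fun setT h1 -> measurable_fun setT h2 ->
  (forall x, 0 <= h1 x)%R -> (forall x, 0 <= h2 x)%R ->
  (forall B, measurable B -> \int[m1]_(x in phi1 @^-1` B) (h1 x)%:E
                           = \int[m2]_(x in phi2 @^-1` B) (h2 x)%:E) ->
  measurable_fun setT g -> (forall x, 0 <= g x)%R ->
  \int[m1]_x (g (phi1 x) * h1 x)%:E = \int[m2]_x (g (phi2 x) * h2 x)%:E.
Proof.
move=> mphi1 mphi2 mh1 mh2 h10 h20 eqB mg g0.
have mEg : measurable_fun setT (EFin \o g) by exact/measurable_EFinP.
pose G := nnsfun_approx measurableT mEg.
have simple d' (S : measurableType d') (m : {measure set S -> \bar R}) phi (h : S -> R)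
    (f : {nnsfun T >-> R}) (s : seq R) : measurable_fun setT phi ->
    measurable_fun setT h -> (forall x, 0 <= h x)%R ->
    (forall x, f x = \sum_(r <- s) `|r| * \1_(f @^-1` [set r]) x)%R ->
    \int[m]_x (f (phi x) * h x)%:E = \sum_(r <- s) `|r|%:E *
       \int[m]_(x in phi @^-1` (f @^-1` [set r])) (h x)%:E.
  move=> mphi mh h0 fE.
  have mA r : measurable (phi @^-1` (f @^-1` [set r])).
    by rewrite -[X in measurable X]setTI; apply: mphi.
  have mhA r : measurable_fun setT ((EFin \o h) \_ (phi @^-1` (f @^-1` [set r]))).
    by apply/(measurable_restrictT _ (mA r)); exact/measurable_funTS/measurable_EFinP.
  have hA0 r x : 0 <= ((EFin \o h) \_ (phi @^-1` (f @^-1` [set r]))) x.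
    by rewrite patchE; case: ifP => // _; rewrite lee_fin.
  transitivity (\int[m]_x (\sum_(r <- s)
      `|r|%:E * ((EFin \o h) \_ (phi @^-1` (f @^-1` [set r]))) x)).
    apply: eq_integral => x _; rewrite EFinM fE -sumEFin ge0_sume_distrl; last first.
      by move=> r _; rewrite lee_fin mulr_ge0.
    apply: eq_bigr => r _; rewrite EFinM -muleA patchE indicE.
    rewrite (_ : (phi x \in f @^-1` [set r]) =
      (x \in phi @^-1` (f @^-1` [set r]))); last by apply/idP/idP; rewrite !inE.
    by case: ifP => _; rewrite ?mul1e ?mul0e.
  rewrite ge0_integral_sum//; last 2 first.
  - by move=> r; exact: measurable_funeM.
  - by move=> r x _; rewrite mule_ge0.
  by apply: eq_bigr => r _; rewrite ge0_integralZl_EFin// -integral_mkcond.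
have limE d' (S : measurableType d') (m : {measure set S -> \bar R}) phi (h : S -> R) :
    measurable_fun setT phi -> measurable_fun setT h -> (forall x, 0 <= h x)%R ->
    \int[m]_x (g (phi x) * h x)%:E =
    limn (fun n => \int[m]_x (G n (phi x) * h x)%:E).
  move=> mphi mh h0; rewrite -monotone_convergence//; last 3 first.
  - move=> n; apply/measurable_EFinP/measurable_funM => //.
    exact: (measurableT_comp (f := G n)).
  - by move=> n x _; rewrite lee_fin mulr_ge0.
  - move=> x _ a b ab; rewrite lee_fin ler_wpM2r//.
    exact/lefP/nd_nnsfun_approx.
  apply: eq_integral => x _; apply/esym/cvg_lim => //.
  under eq_fun do rewrite EFinM.
  rewrite EFinM; apply: cvgeZr => //.
  by apply: (@cvg_nnsfun_approx _ _ _ _ measurableT _ mEg) => //= y _; rewrite lee_fin.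
rewrite !limE//; congr (limn _); apply/funext => n.
have [s sE] := nnsfun_sum_indic (G n).
rewrite !(simple _ _ _ _ _ (G n) s)//.
by apply: eq_bigr => r _; congr (_ * _); exact: eqB.
Qed.
End change_of_variables.

(** * Expectations of products of independent variables *)

Section independence.
Local Open Scope ereal_scope.
Context {R : realType} d (T : measurableType d) (P : probability T R).

(** Used to restrict the array of noise variables to one row or one column. *)
Lemma mutually_independent_comp (I I' : finType) (Y : I -> {RV P >-> R})
    (phi : I' -> I) : injective phi -> mutually_independent Y ->
  mutually_independent (fun i => Y (phi i)).
Proof.
move=> phi_inj indY J B mB.
pose B' i := if [pick i' | phi i' == i] is Some i' then B i' else setT.
have B'E i : B' (phi i) = B i.
  rewrite /B'; case: pickP => [j /eqP /phi_inj -> //|/(_ i)].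
  by rewrite eqxx.
have mB' i : measurable (B' i) by rewrite /B'; case: pickP.
have := indY (phi @: J)%SET B' mB'.
rewrite big_imset/=; last by move=> x y _ _; exact: phi_inj.
under eq_bigr do rewrite B'E.
move=> <-; congr (P _); apply/seteqP; split => x Hx i/=.
  by move=> /imsetP[j Jj ->]; rewrite B'E; exact: Hx.
by move=> Ji; have := Hx (phi i); rewrite /= B'E; apply; exact: imset_f.
Qed.

(** Independence only speaks of indicator functions. They are replaced by the
[g i] one index at a time, the induction hypothesis being stated for arbitrary
sets at the other indices: varying the set at the index [x] shows that the product
of the other factors weights the law of [Y x] by a constant. *)
Lemma integral_prod_independent (I : finType) (Y : I -> {RV P >-> R})
    (g : I -> R -> R) (c : I -> R) :
  mutually_independent Y ->
  (forall i, measurable_fun setT (g i)) ->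
  (forall i x, 0 <= g i x)%R ->
  (forall i, \int[P]_w (g i (Y i w))%:E = (c i)%:E) ->
  \int[P]_w (\prod_i g i (Y i w))%:E = (\prod_i c i)%:E.
Proof.
move=> indY mg g0 gc.
have mY i : measurable_fun setT (Y i) by [].
have c0 i : (0 <= c i)%R.
  by rewrite -lee_fin -gc; apply: integral_ge0 => w _; rewrite lee_fin.
pose F (S : {set I}) (B : I -> set R) i y : R :=
  if i \in S then g i y else \1_(B i) y.
pose p (B : set R) i : R := fine (P (Y i @^-1` B)).
have pE B i : measurable B -> P (Y i @^-1` B) = (p B i)%:E.
  move=> mB; rewrite fineK// fin_num_measure//.
  by rewrite -[X in measurable X]setTI; exact: mY.
suff main : forall (S : {set I}) B, (forall i, measurable (B i)) ->
    \int[P]_w (\prod_i F S B i (Y i w))%:E =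
    (\prod_i (if i \in S then c i else p (B i) i))%:E.
  have := main [set: I]%SET (fun=> setT) (fun=> measurableT).
  under eq_integral do under eq_bigr do rewrite /F inE.
  by under [X in _ = X%:E -> _]eq_bigr do rewrite inE.
have F0 S B i y : (0 <= F S B i y)%R by rewrite /F; case: ifP.
have mF S B i : measurable (B i) -> measurable_fun setT (F S B i).
  by move=> mB; rewrite /F; case: (i \in S) => //; exact: measurable_indic.
move=> S; have [m] := ubnP #|S|; elim: m S => // m IH S Sm B mB.
have [->|[x xS]] := set_0Vmem S.
  under eq_integral do under eq_bigr do rewrite /F inE.
  under [X in _ = X%:E]eq_bigr do rewrite inE.
  rewrite -prodEFin; under [RHS]eq_bigr do rewrite -pE//.
  have := indY [set: I]%SET B mB.
  under [X in _ = X -> _]eq_bigl do rewrite inE.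
  set E := (X in P X) => <-.
  have mE : measurable E.
    apply: fin_bigcap_measurable; first exact: finite_finset.
    by move=> i _; rewrite -[X in measurable X]setTI; exact: mY.
  rewrite -[E]setIT -integral_indic//; apply: eq_integral => w _; congr EFin.
  rewrite indicE; case: (boolP (w \in E)) => wE.
    rewrite big1// => i _; rewrite indicE mem_set//.
    by move: wE; rewrite inE => /(_ i); apply; rewrite /= inE.
  have /existsNP[i /not_implyP[_ wi]] : ~ E w by move: wE; rewrite notin_setE.
  by rewrite (bigD1 i)//= indicE memNset ?mul0r.
pose H w : R := (\prod_(i | i != x) F (S :\ x)%SET B i (Y i w))%R.
pose K : R := (\prod_(i | i != x) (if i \in (S :\ x)%SET then c i else p (B i) i))%R.
have K0 : (0 <= K)%R.
  by apply: prodr_ge0 => i _; case: ifP => // _; exact: fine_ge0.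
transitivity (\int[P]_w (g x (Y x w) * H w)%:E).
  apply: eq_integral => w _; congr EFin.
  rewrite (bigD1 x)//= {1}/F xS; congr (_ * _)%R; apply: eq_bigr => i ix.
  by rewrite /F !inE ix.
rewrite (@ge0_integral_comp_weight _ _ _ _ _ _ _ P P (Y x) (Y x) H (fun=> K))//.
- under eq_integral do rewrite mulrC EFinM.
  rewrite ge0_integralZl_EFin//; last 2 first.
  - by move=> w _; rewrite lee_fin.
  - exact/measurable_EFinP/measurableT_comp.
  rewrite gc.
  rewrite -EFinM; congr EFin.
  rewrite (bigD1 x)//= xS mulrC; congr (_ * _)%R; apply: eq_bigr => i ix.
  by rewrite !inE ix.
- rewrite /H; under eq_fun do rewrite -big_filter.
  apply: measurable_prod => i _.
  exact: (measurableT_comp (mF _ _ _ (mB i))).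
- by move=> w; apply: prodr_ge0.
- move=> A mA.
  pose B' i := if i == x then A else B i.
  have mB' i : measurable (B' i) by rewrite /B'; case: ifP.
  have B'x : B' x = A by rewrite /B' eqxx.
  have E : \int[P]_w (\prod_i F (S :\ x)%SET B' i (Y i w))%:E =
           (p A x * \prod_(i | i != x)
                (if i \in S :\ x then c i else p (B' i) i))%:E.
    rewrite IH//; last by move: Sm; rewrite (cardsD1 x) xS.
    by rewrite (bigD1 x)//= !inE eqxx/= B'x.
  transitivity (p A x * K)%:E; last first.
    rewrite integral_cst//; last by rewrite -[X in measurable X]setTI; exact: mY.
    by rewrite EFinM muleC; congr (_ * _); exact/esym/pE.
  transitivity (\int[P]_w (\prod_i F (S :\ x)%SET B' i (Y i w))%:E).
    rewrite integral_mkcond; apply: eq_integral => w _.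
    rewrite (bigD1 x)//= {1}/F !inE eqxx/= B'x indicE patchE.
    rewrite (_ : (Y x w \in A) = (w \in Y x @^-1` A)); last first.
      by apply/idP/idP; rewrite !inE.
    case: ifP => _; rewrite ?mul0r// mul1r; congr EFin; apply: eq_bigr => i ix.
    by rewrite /F !inE ix /= /B' (negbTE ix).
  rewrite E; congr ((_ * _)%R)%:E; apply: eq_bigr => i ix.
  by rewrite /B' (negbTE ix).
Qed.

Lemma integral_density (Y : {RV P >-> R}) (f g : R -> R) :
  has_density Y f -> measurable_fun setT f -> (forall x, 0 <= f x)%R ->
  measurable_fun setT g -> (forall x, 0 <= g x)%R ->
  \int[P]_w (g (Y w))%:E = \int[lebesgue_measure]_x (g x * f x)%:E.
Proof.
move=> Yf mf f0 mg g0.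
transitivity (\int[P]_w (g (Y w) * 1)%:E).
  by apply: eq_integral => w _; rewrite mulr1.
apply: (@ge0_integral_comp_weight R _ _ _ T (measurableTypeR R) (measurableTypeR R)
  P lebesgue_measure Y id (fun=> 1%R) f g) => //.
  by have mY : measurable_fun setT (Y : T -> R) by []; exact: mY.
move=> B mB; transitivity (P (Y @^-1` B)); last exact: Yf.
rewrite integral_cst ?mul1e//.
by rewrite -[X in measurable X]setTI; exact: measurable_funPT.
Qed.

Lemma integral_expR_sum_independent (I : finType) (Y : I -> {RV P >-> R})
    (h : I -> R -> R) (c : I -> R) :
  mutually_independent Y -> (forall i, measurable_fun setT (h i)) ->
  (forall i, \int[P]_w (expR (h i (Y i w)))%:E = (c i)%:E) ->
  \int[P]_w (expR (\sum_i h i (Y i w)))%:E = (\prod_i c i)%:E.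
Proof.
move=> indY mh hc.
rewrite -(integral_prod_independent indY (g := fun i y => expR (h i y)))//.
- by apply: eq_integral => w _; rewrite expR_sum.
- by move=> i; exact: measurableT_comp.
Qed.

End independence.

(** * Integrals against the Laplace density *)

Section laplace.
Context {R : realType}.
Local Notation mu := (@lebesgue_measure R).

Lemma laplace_pdf_ge0 (m s x : R) : 0 < s -> 0 <= laplace_pdf m s x.
Proof. by move=> s0; rewrite mulr_ge0 ?expR_ge0// invr_ge0 mulr_ge0// ltW. Qed.

Lemma continuous_laplace_pdf (m s : R) : continuous (laplace_pdf m s).
Proof.
move=> x; apply: (@continuousM _ R^o (fun=> (2 * s)^-1)
  (fun x => expR (- (`|x - m| / s)))); first exact: cst_continuous.
apply: continuous_comp; last exact: continuous_expR.
apply: (@continuousN _ R^o).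
apply: (@continuousM _ R^o (fun x => `|x - m|) (fun=> s^-1)); last exact: cst_continuous.
apply: continuous_comp; last exact: norm_continuous.
by apply: (@continuousB _ R^o) => //; exact: cst_continuous.
Qed.

Lemma measurable_laplace_pdf (m s : R) : measurable_fun setT (laplace_pdf m s).
Proof. by apply: continuous_measurable_fun; exact: continuous_laplace_pdf. Qed.

Lemma integral_expRN (r : R) : 0 < r ->
  (\int[mu]_(x in `[0%R, +oo[) (expR (- (r * x)))%:E = (r^-1)%:E)%E.
Proof.
move=> r0; have := integral_exponential_pdf r0.
have mr : measurable_fun setT (fun x : R => expR (- (r * x))).
  by apply/measurableT_comp => //; apply/measurableT_comp => //; exact: measurable_funM.
rewrite (_ : exponential_pdf r =
    (fun x => r * expR (- (r * x))) \_ `[0, +oo[); last first.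
  by rewrite /exponential_pdf; congr (_ \_ _); apply/funext => x; rewrite mulNr.
rewrite [X in X = _ -> _](_ : _ =
    \int[mu]_(x in `[0%R, +oo[) (r * expR (- (r * x)))%:E)%E; last first.
  rewrite [RHS]integral_mkcond; apply: eq_integral => x _.
  by rewrite !patchE; case: ifP.
under eq_integral do rewrite EFinM.
rewrite ge0_integralZl_EFin//; last 2 first.
- exact/measurable_EFinP/measurable_funTS.
- exact: ltW.
move=> /(congr1 (fun z => (r^-1)%:E * z)%E).
by rewrite muleA -EFinM mulVf ?gt_eqF// mul1e mule1.
Qed.

(** Folds the line at 0; on the half-line the density is exponential. *)
Lemma integral_laplace_half (g : R -> R) : measurable_fun setT g ->
  (forall x, 0 <= g x) ->
  (\int[mu]_x (g x * laplace_pdf 0 1 x)%:E =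
   \int[mu]_(x in `[0%R, +oo[) (2^-1 * ((g x + g (- x)) * expR (- x)))%:E)%E.
Proof.
move=> mg g0.
pose f x : R := g x * laplace_pdf 0 1 x.
have f0 x : 0 <= f x by rewrite mulr_ge0// laplace_pdf_ge0.
have mf : measurable_fun setT f.
  by apply: measurable_funM => //; exact: measurable_laplace_pdf.
have mfN : measurable_fun setT (fun x : R => f (- x)) by apply: (measurableT_comp mf).
rewrite -(setUv (`[0, +oo[ : set R)) setCitvr ge0_integral_setU//=; last 3 first.
- by apply/measurable_EFinP; exact: measurable_funTS.
- by move=> x _; rewrite lee_fin f0.
- by rewrite -setCitvr; apply/disj_setPCl.
rewrite [X in (_ + X)%E](_ : _ = \int[mu]_(x in `]-oo, 0%R]) (f x)%:E)%E; last first.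
  by rewrite integral_itv_bndo_bndc//; apply/measurable_EFinP; exact: measurable_funTS.
have -> : (\int[mu]_(x in `]-oo, 0%R]) (f x)%:E =
    \int[mu]_(x in `[0%R, +oo[) (f (- x))%:E)%E.
  rewrite (@ge0_integration_by_substitution0 _ (fun x => (f (- x))%:E)).
  - by apply: eq_integral => x _; rewrite opprK.
  - exact/measurable_EFinP.
  - by move=> x; rewrite lee_fin.
rewrite -ge0_integralD//; last 4 first.
- by move=> x _; rewrite lee_fin f0.
- by apply/measurable_EFinP; exact: measurable_funTS.
- by move=> x _; rewrite lee_fin f0.
- by apply/measurable_EFinP; exact: measurable_funTS.
apply: eq_integral => x; rewrite inE/= in_itv/= andbT => x0.
rewrite -EFinD /f /laplace_pdf !subr0 !divr1 normrN ger0_norm// mulr1.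
by congr EFin; ring.
Qed.

(** The two halves of the line contribute [1 / (1 - t)] and [1 / (1 + t)]. *)
Lemma laplace_mgf (t : R) : `|t| < 1 ->
  (\int[mu]_x (expR (t * x) * laplace_pdf 0 1 x)%:E = ((1 - t ^+ 2)^-1)%:E)%E.
Proof.
move=> t1; have /andP[tN tP] : -1 < t < 1 by rewrite -ltr_norml.
rewrite integral_laplace_half; last 2 first.
- by apply: measurableT_comp => //; exact: measurable_funM.
- by move=> x; exact: expR_ge0.
have mr (r : R) : measurable_fun (`[0, +oo[ : set R) (fun x : R => (expR (- (r * x)))%:E).
  apply/measurable_EFinP/measurable_funTS.
  by apply/measurableT_comp => //; apply/measurableT_comp => //; exact: measurable_funM.
transitivity (\int[mu]_(x in `[0%R, +oo[)
   ((2^-1)%:E * ((expR (- ((1 - t) * x)))%:E + (expR (- ((1 + t) * x)))%:E)))%E.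
  apply: eq_integral => x _; rewrite -EFinD -EFinM mulrDl -!expRD.
  by congr (_ * (expR _ + expR _))%:E; ring.
rewrite ge0_integralZl_EFin//; last 2 first.
- by move=> x _; rewrite -EFinD lee_fin addr_ge0 ?expR_ge0.
- by apply: emeasurable_funD; exact: mr.
rewrite ge0_integralD//; last 2 first.
- exact: mr.
- exact: mr.
rewrite !integral_expRN; [|lra|lra].
rewrite -EFinD -EFinM; congr EFin; field.
by rewrite !gt_eqF//=; nra.
Qed.

Lemma laplace_abs_mgf (t : R) : t < 1 ->
  (\int[mu]_x (expR (t * `|x|) * laplace_pdf 0 1 x)%:E = ((1 - t)^-1)%:E)%E.
Proof.
move=> t1; rewrite integral_laplace_half; last 2 first.
- by apply: measurableT_comp => //; exact: measurable_funM.
- by move=> x; exact: expR_ge0.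
rewrite -integral_expRN ?subr_gt0//; apply: eq_integral => x.
rewrite inE/= in_itv/= andbT => x0; congr EFin.
rewrite normrN ger0_norm//.
rewrite (_ : - ((1 - t) * x) = t * x - x); last by ring.
by rewrite expRD; field.
Qed.

(** The law of [m + s * eps] has density [laplace_pdf m s] when [eps] is a
standard Laplace variable. *)
Lemma integral_laplace_affine (m s : R) (g : R -> R) : 0 < s -> continuous g ->
  (forall x, 0 <= g x) ->
  (\int[mu]_x (g (m + s * x) * laplace_pdf 0 1 x)%:E =
   \int[mu]_x (g x * laplace_pdf m s x)%:E)%E.
Proof.
move=> s0 cg g0.
pose F (x : R) : R := m + s * x.
have dF (x : R) : is_derive x (1 : R) F (0 + s *: (1 : R)).
  by rewrite (_ : F = cst m + s *: (id : R -> R)); [exact: is_deriveD|exact/funext].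
have F' : (F^`())%classic = cst s.
  apply/funext => x; rewrite derive1E (@derive_val _ _ _ _ _ _ _ (dF x)) add0r.
  exact: mulr1.
rewrite (@increasing_ge0_integration_by_substitutionT _ F
  (fun x => g x * laplace_pdf m s x)).
- apply: eq_integral => x _; congr EFin; rewrite F' !fctE /F /laplace_pdf -mulrA.
  congr (_ * _).
  rewrite subr0 divr1 mulr1 (addrC m) addrK normrM gtr0_norm// (mulrC s) mulfK ?gt_eqF//.
  by rewrite mulrAC invfM -(mulrA 2^-1) mulVf ?gt_eqF// mulr1.
- by move=> x y xy; rewrite ltrD2l ltr_pM2l.
- by rewrite F'; exact: cst_continuous.
- by rewrite F'; exact: is_cvg_cst.
- by rewrite F'; exact: is_cvg_cst.
- by move=> x; have [] := dF x.
- apply/cvgrNyPle => A; near=> x.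
  have xA : x <= s^-1 * (A - m) by near: x; apply: nbhs_ninfty_le; exact: num_real.
  by rewrite /F -lerBrDl -ler_pdivlMl.
- apply/cvgryPge => A; near=> x.
  have xA : s^-1 * (A - m) <= x by near: x; apply: nbhs_pinfty_ge; exact: num_real.
  by rewrite /F -lerBlDl -ler_pdivrMl.
- by move=> x; apply: continuousM; [exact: cg|exact: continuous_laplace_pdf].
- by move=> x; rewrite mulr_ge0// laplace_pdf_ge0.
Unshelve. all: by end_near. Qed.

End laplace.

(** * Chernoff divergences and product densities *)

Section chernoff_bounds.
Context {R : realType} (d : nat).
Implicit Types f g : d.-tuple R -> R.

(** The infimum in the definition need not be attained. Allowing the factor
[exp 1] makes room for a [t] at which the integral is below the bound; the factor
is harmless since divergences tend to infinity. *)
Lemma chernoff_exponent f g (c : R) : (c%:E <= Defs.chernoff f g)%E ->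
  exists2 t : R, 0 < t < 1 &
    (\int[lebesgue_measure_Rd d]_x (f x `^ t * g x `^ (1 - t))%:E
       < (expR (1 - c))%:E)%E.
Proof.
rewrite /Defs.chernoff; set A := [set _ | _ in _] => cA.
have A0 : (0 <= ereal_inf A)%E.
  apply: le_ereal_inf_tmp => _ [t _ <-]; apply: integral_ge0 => x _.
  by rewrite lee_fin mulr_ge0// powR_ge0.
have : (ereal_inf A < (expR (1 - c))%:E)%E.
  rewrite -(lneK_eq (ereal_inf A)) in A0; rewrite -(eqP A0).
  apply: (@le_lt_trans _ _ (expeR (- c%:E))).
    by rewrite lee_expeR leeNr.
  by rewrite /= lte_fin ltr_expR; lra.
move=> /ereal_inf_lt[_ [t /= + <-] H]; rewrite in_itv/= => t01.
by exists t.
Qed.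

Lemma chernoff_le f g (c : R) :
  (forall t : R, 0 < t < 1 -> ((expR (- c))%:E <=
    \int[lebesgue_measure_Rd d]_x (f x `^ t * g x `^ (1 - t))%:E)%E) ->
  (Defs.chernoff f g <= c%:E)%E.
Proof.
move=> H; rewrite /Defs.chernoff leeNl -EFinN.
set A := [set _ | _ in _].
have cA : ((expR (- c))%:E <= ereal_inf A)%E.
  apply: le_ereal_inf_tmp => _ [t /= + <-]; rewrite in_itv/=; exact: H.
have A0 : (0 <= ereal_inf A)%E.
  by apply: le_trans cA; rewrite lee_fin expR_ge0.
rewrite -(lneK_eq (ereal_inf A)) in A0; rewrite -(eqP A0) in cA.
by rewrite -lee_expeR.
Qed.

End chernoff_bounds.

Section integral_Rd.
Context {R : realType}.
Local Notation mu := (@lebesgue_measure R).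

(** Tonelli on the recursive definition of the Lebesgue measure on [R^d]. *)
Lemma integral_Rd_prod (d : nat) (g : 'I_d -> R -> R) (c : 'I_d -> R) :
  (forall l, measurable_fun setT (g l)) -> (forall l x, 0 <= g l x) ->
  (forall l, (\int[mu]_x (g l x)%:E = (c l)%:E)%E) ->
  (\int[lebesgue_measure_Rd d]_x (\prod_(l < d) g l (tnth x l))%:E =
   (\prod_(l < d) c l)%:E)%E.
Proof.
elim: d g c => [|d IH] g c mg g0 gc.
  rewrite big_ord0; transitivity (\int[dirac ([tuple] : 0.-tuple R)]_x (1%:E : \bar R))%E.
    by apply: eq_integral => x _; rewrite big_ord0.
  by rewrite integral_dirac// diracE mem_set// mul1e.
have mG n (h : 'I_n -> R -> R) : (forall l, measurable_fun setT (h l)) ->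
    measurable_fun setT (fun x : n.-tuple R => \prod_(l < n) h l (tnth x l)).
  move=> mh; apply: measurable_prod => l _.
  exact: (measurableT_comp (mh l) (measurable_tnth l)).
have G0 n (h : 'I_n -> R -> R) : (forall l x, 0 <= h l x) ->
    forall x : n.-tuple R, 0 <= \prod_(l < n) h l (tnth x l).
  by move=> h0 x; apply: prodr_ge0.
transitivity (\int[pushforward (mu \x lebesgue_measure_Rd d)%E (@tcons R d)]_x
   (\prod_(l < d.+1) g l (tnth x l))%:E)%E; first by [].
rewrite ge0_integral_pushforward//=; last 3 first.
- exact: measurable_tcons.
- apply/measurable_EFinP; exact: mG.
- by move=> x _; rewrite lee_fin; exact: G0.
rewrite preimage_setT fubini_tonelli1//=; last 2 first.
- apply/measurable_EFinP.
  exact: (measurableT_comp (mG _ _ mg) (@measurable_tcons R d)).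
- by move=> x; rewrite lee_fin; exact: G0.
rewrite /fubini_F/=.
transitivity (\int[mu]_x ((g ord0 x)%:E *
    (\prod_(l < d) c (lift ord0 l))%:E))%E.
  apply: eq_integral => x _.
  rewrite -(IH (fun l => g (lift ord0 l)))//.
  rewrite -ge0_integralZl_EFin//; last 2 first.
  - by move=> y _; rewrite lee_fin; apply: prodr_ge0.
  - by apply/measurable_EFinP; exact: (mG _ (fun l => g (lift ord0 l))).
  apply: eq_integral => y _; rewrite -EFinM; congr EFin.
  rewrite big_ord_recl/= (tnth_nth 0)/=; congr (_ * _).
  by apply: eq_bigr => l _; rewrite !(tnth_nth 0).
have c0 l : 0 <= c l.
  by rewrite -lee_fin -gc; apply: integral_ge0 => x _; rewrite lee_fin.
rewrite ge0_integralZr//; last 3 first.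
- by apply/measurable_EFinP; exact: mg.
- by move=> x _; rewrite lee_fin.
- by rewrite lee_fin; apply: prodr_ge0.
by rewrite gc -EFinM big_ord_recl.
Qed.

End integral_Rd.

Section laplace_likelihood.
Context {R : realType}.
Local Notation mu := (@lebesgue_measure R).

(** Up to the constant [- ln 2], the logarithm of the density; it is also the
summand of [laplace_score]. *)
Definition laplace_loglik (m s x : R) : R := - ln s - `|x - m| / s.

Lemma laplace_pdfE (m s x : R) : 0 < s ->
  laplace_pdf m s x = expR (laplace_loglik m s x - ln 2).
Proof.
move=> s0; rewrite /laplace_pdf /laplace_loglik invfM addrAC expRD; congr (_ * _).
by rewrite addrC expRD !expRN !lnK ?posrE.
Qed.

Lemma continuous_laplace_loglik (m s : R) : continuous (laplace_loglik m s).
Proof.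
move=> x; apply: (@continuousB _ _ _ (fun=> - ln s : R^o)
  (fun x : R => `|x - m| / s : R^o)); first exact: cst_continuous.
apply: (@continuousM _ R^o (fun x => `|x - m|) (fun=> s^-1)); last exact: cst_continuous.
apply: continuous_comp; last exact: norm_continuous.
by apply: (@continuousB _ R^o) => //; exact: cst_continuous.
Qed.

Lemma integral_laplace_pdf (m s : R) : 0 < s ->
  (\int[mu]_x (laplace_pdf m s x)%:E = 1)%E.
Proof.
move=> s0.
have := @integral_laplace_affine R m s (fun=> 1) s0 (@cst_continuous _ _ _) (fun=> ler01).
under [X in _ = X -> _]eq_integral do rewrite mul1r.
move=> <-; have := @laplace_mgf R 0; rewrite normr0 => /(_ ltr01).
under eq_integral do rewrite mul0r expR0.
by move=> ->; rewrite expr0n subr0 invr1.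
Qed.

(** A weighted geometric mean is at most the sum of the two densities, which has
integral 2. *)
Lemma laplace_geometric_mean_integrable (m1 s1 m2 s2 t : R) :
  0 < s1 -> 0 < s2 -> 0 < t < 1 ->
  exists c : R, (\int[mu]_x (laplace_pdf m1 s1 x `^ t *
                             laplace_pdf m2 s2 x `^ (1 - t))%:E = c%:E)%E.
Proof.
move=> s10 s20 /andP[t0 t1].
set I := (\int[_]_x _)%E.
have mG (m s r : R) : measurable_fun setT (fun x => laplace_pdf m s x `^ r).
  exact: (measurableT_comp (measurable_powR _) (measurable_laplace_pdf m s)).
have I2 : (I <= 2%:E)%E.
  rewrite (_ : 2%:E = \int[mu]_x ((laplace_pdf m1 s1 x)%:E +
      (laplace_pdf m2 s2 x)%:E))%E; last first.
    rewrite ge0_integralD//; last 4 first.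
    - by move=> x _; rewrite lee_fin laplace_pdf_ge0.
    - by apply/measurable_EFinP; exact: measurable_laplace_pdf.
    - by move=> x _; rewrite lee_fin laplace_pdf_ge0.
    - by apply/measurable_EFinP; exact: measurable_laplace_pdf.
    by rewrite !integral_laplace_pdf// -EFinD.
  apply: ge0_le_integral => //.
  - by move=> x _; rewrite lee_fin mulr_ge0// powR_ge0.
  - by apply/measurable_EFinP/measurable_funM; exact: mG.
  - by apply: emeasurable_funD; apply/measurable_EFinP; exact: measurable_laplace_pdf.
  - move=> x _; rewrite -EFinD lee_fin !laplace_pdfE// -!expRM -expRD.
    set u := (X in X * t); set v := (X in X * (1 - t)).
    have [uv|vu] := leP u v.
      have : expR (u * t + v * (1 - t)) <= expR v by rewrite ler_expR; nra.
      by have := expR_ge0 u; lra.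
    have : expR (u * t + v * (1 - t)) <= expR u by rewrite ler_expR; nra.
    by have := expR_ge0 v; lra.
exists (fine I); rewrite fineK// ge0_fin_numE; first exact: (le_lt_trans I2 (ltry _)).
by apply: integral_ge0 => x _; rewrite lee_fin mulr_ge0// powR_ge0.
Qed.

(** Both densities are bounded below by the density of scale [smin] at [m2],
up to the factor [exp (- D / smin) * smin / smax]. *)
Lemma integral_laplace_geometric_mean_ge (m1 s1 m2 s2 t smin smax D : R) :
  0 < smin -> smin <= s1 <= smax -> smin <= s2 <= smax -> 0 < t < 1 ->
  `|m1 - m2| <= D ->
  ((expR (- (D / smin + ln (smax / smin))))%:E <=
   \int[mu]_x (laplace_pdf m1 s1 x `^ t * laplace_pdf m2 s2 x `^ (1 - t))%:E)%E.
Proof.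
move=> smin0 /andP[s1l s1u] /andP[s2l s2u] /andP[t0 t1] mD.
have s10 := lt_le_trans smin0 s1l; have s20 := lt_le_trans smin0 s2l.
have smax0 := lt_le_trans s10 s1u.
set K := _ + _.
rewrite (_ : (expR (- K))%:E =
    \int[mu]_x ((expR (- K))%:E * (laplace_pdf m2 smin x)%:E))%E; last first.
  rewrite ge0_integralZl_EFin ?expR_ge0//; last 2 first.
  - by move=> x _; rewrite lee_fin laplace_pdf_ge0.
  - by apply/measurable_EFinP; exact: measurable_laplace_pdf.
  by rewrite integral_laplace_pdf// mule1.
have mG (m s r : R) : measurable_fun setT (fun x => laplace_pdf m s x `^ r).
  exact: (measurableT_comp (measurable_powR _) (measurable_laplace_pdf m s)).
apply: ge0_le_integral => //.
- by move=> x _; rewrite -EFinM lee_fin mulr_ge0 ?expR_ge0// laplace_pdf_ge0.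
- by apply: measurable_funeM; apply/measurable_EFinP; exact: measurable_laplace_pdf.
- by apply/measurable_EFinP/measurable_funM; exact: mG.
move=> x _; rewrite -EFinM lee_fin !laplace_pdfE// -!expRM -!expRD ler_expR.
rewrite /laplace_loglik /K ln_div ?posrE//.
have lnle s : smin <= s <= smax -> ln s <= ln smax.
  by move=> /andP[sl su]; rewrite ler_ln ?posrE// (lt_le_trans smin0).
have L1 := lnle _ (introT andP (conj s1l s1u)).
have L2 := lnle _ (introT andP (conj s2l s2u)).
have A s u : smin <= s -> 0 <= u -> u / s <= u / smin.
  by move=> sl u0; rewrite ler_wpM2l// lef_pV2 ?posrE// (lt_le_trans smin0).
have A1 : `|x - m1| / s1 <= (`|x - m2| + D) / smin.
  apply: le_trans (A _ _ s1l (normr_ge0 _)) _.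
  rewrite ler_pM2r ?invr_gt0// -(subrKA m2); apply: le_trans (ler_normD _ _) _.
  by rewrite lerD2l distrC.
have A2 := A _ _ s2l (normr_ge0 (x - m2)).
rewrite mulrDl in A1.
have D0 : 0 <= D / smin by rewrite divr_ge0 ?(ltW smin0)// (le_trans _ mD).
move: L1 L2 A1 A2 D0.
move: (ln s1) (ln s2) (ln smax) (ln smin) (ln 2) (`|x - m1| / s1) (`|x - m2| / s2)
  (`|x - m2| / smin) (D / smin) => a b c e l p q r w L1 L2 A1 A2 D0.
have U1 : - c - r - w - l <= - a - p - l by lra.
have U2 : - c - r - w - l <= - b - q - l by lra.
nra.
Qed.

End laplace_likelihood.

(** * Products of Laplace laws *)

Section laplace_products.
Context {R : realType} (d : nat).
Local Notation mu := (@lebesgue_measure R).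
Implicit Types m s : 'I_d -> R.

Lemma powR_prod (r : R) (u : 'I_d -> R) : (forall l, 0 <= u l) ->
  (\prod_(l < d) u l) `^ r = \prod_(l < d) u l `^ r.
Proof.
move=> u0.
suff [] : 0 <= \prod_(l < d) u l /\
  (\prod_(l < d) u l) `^ r = \prod_(l < d) u l `^ r by [].
apply: (big_ind2 (fun x y => 0 <= x /\ x `^ r = y)).
- by rewrite powR1.
- move=> x1 x2 y1 y2 [x10 <-] [y10 <-]; split; first exact: mulr_ge0.
  by rewrite powRM.
- by move=> i _; split.
Qed.

(** Real powers commute with the product over the coordinates, so that Tonelli
applies to the integral defining the Chernoff divergence. *)
Lemma integral_laplace_density_mean m1 s1 m2 s2 (t : R) :
  (forall l, 0 < s1 l) -> (forall l, 0 < s2 l) -> 0 < t < 1 ->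
  exists2 c : 'I_d -> R,
    forall l, (\int[mu]_x (laplace_pdf (m1 l) (s1 l) x `^ t *
                           laplace_pdf (m2 l) (s2 l) x `^ (1 - t))%:E
               = (c l)%:E)%E &
    (\int[lebesgue_measure_Rd d]_x (laplace_density m1 s1 x `^ t *
        laplace_density m2 s2 x `^ (1 - t))%:E = (\prod_(l < d) c l)%:E)%E.
Proof.
move=> s10 s20 t01.
have /choice[c cE] l :=
  laplace_geometric_mean_integrable (m1 l) (m2 l) (s10 l) (s20 l) t01.
exists c => //; rewrite -(integral_Rd_prod _ _ cE).
- apply: eq_integral => x _; congr EFin.
  rewrite /laplace_density !powR_prod ?big_split//= => l; exact: laplace_pdf_ge0.
- move=> l; apply: measurable_funM.
    exact: (measurableT_comp (measurable_powR _) (measurable_laplace_pdf _ _)).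
  exact: (measurableT_comp (measurable_powR _) (measurable_laplace_pdf _ _)).
- by move=> l x; rewrite mulr_ge0// powR_ge0.
Qed.

(** Only the separation of the centres makes the divergence large. This turns a
lower bound on the divergence into a lower bound on the separation. *)
Lemma chernoff_laplace_le m1 s1 m2 s2 (smin smax D : R) : 0 < smin ->
  (forall l, smin <= s1 l <= smax) -> (forall l, smin <= s2 l <= smax) ->
  (forall l, `|m1 l - m2 l| <= D) ->
  (Defs.chernoff (laplace_density m1 s1) (laplace_density m2 s2)
    <= (d%:R * (D / smin + ln (smax / smin)))%:E)%E.
Proof.
move=> smin0 Hs1 Hs2 HD; apply: chernoff_le => t t01.
have s10 l : 0 < s1 l by have /andP[h _] := Hs1 l; exact: lt_le_trans h.
have s20 l : 0 < s2 l by have /andP[h _] := Hs2 l; exact: lt_le_trans h.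
have [c cE ->] := integral_laplace_density_mean m1 m2 s10 s20 t01.
rewrite lee_fin -mulrN expRM_natl -[leLHS]/(_ ^+ d) -[X in _ ^+ X]card_ord -prodr_const.
apply: ler_prod => l _; rewrite expR_ge0/=.
by rewrite -lee_fin -cE; exact: integral_laplace_geometric_mean_ge.
Qed.

(** Against the density [f2], the weight [exp (t * (log f1 - log f2))] becomes
[f1 ^ t * f2 ^ (1 - t)]: this is where the Chernoff divergence comes from. *)
Lemma likelihood_ratio_mgf dT (T : measurableType dT) (P : probability T R)
    (Y : 'I_d -> {RV P >-> R}) m1 s1 m2 s2 (t : R) :
  mutually_independent Y -> (forall l, has_density (Y l) (laplace_pdf 0 1)) ->
  (forall l, 0 < s1 l) -> (forall l, 0 < s2 l) -> 0 < t < 1 ->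
  (\int[P]_w (expR (t * \sum_(l < d)
      (laplace_loglik (m1 l) (s1 l) (m2 l + s2 l * Y l w) -
       laplace_loglik (m2 l) (s2 l) (m2 l + s2 l * Y l w))))%:E =
   \int[lebesgue_measure_Rd d]_x (laplace_density m1 s1 x `^ t *
        laplace_density m2 s2 x `^ (1 - t))%:E)%E.
Proof.
move=> indY lapY s10 s20 t01.
have [c cE ->] := integral_laplace_density_mean m1 m2 s10 s20 t01.
pose r l y : R := t * (laplace_loglik (m1 l) (s1 l) y - laplace_loglik (m2 l) (s2 l) y).
pose h l y : R := r l (m2 l + s2 l * y).
have cr l : continuous (r l).
  move=> x; apply: (@continuousM _ R^o (fun=> t) (fun y =>
    laplace_loglik (m1 l) (s1 l) y - laplace_loglik (m2 l) (s2 l) y));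
    first exact: cst_continuous.
  by apply: (@continuousB _ _ _ (laplace_loglik (m1 l) (s1 l) : _ -> R^o)
    (laplace_loglik (m2 l) (s2 l) : _ -> R^o)); exact: continuous_laplace_loglik.
have mh l : measurable_fun setT (h l).
  apply: (@measurableT_comp _ _ _ _ _ _ (r l)).
    by apply: continuous_measurable_fun; exact: cr.
  by apply: measurable_funD => //; exact: measurable_funM.
rewrite -(integral_expR_sum_independent indY mh).
  by apply: eq_integral => w _; rewrite mulr_sumr.
move=> l.
rewrite (@integral_density _ _ _ _ _ _ (fun y => expR (h l y)) (lapY l))//; last 3 first.
- exact: measurable_laplace_pdf.
- by move=> x; exact: laplace_pdf_ge0.
- exact: measurableT_comp.
rewrite (@integral_laplace_affine _ (m2 l) (s2 l) (fun y => expR (r l y)))//; last first.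
  by move=> x; apply: continuous_comp; [exact: cr|exact: continuous_expR].
rewrite -cE; apply: eq_integral => x _; congr EFin.
rewrite !laplace_pdfE// -!expRM -!expRD /r; congr expR.
by ring.
Qed.

End laplace_products.

Section laplace_noise.
Context {R : realType} dT (T : measurableType dT) (P : probability T R).
Context (I : finType) (Y : I -> {RV P >-> R}).
Hypothesis indY : mutually_independent Y.
Hypothesis lapY : forall i, has_density (Y i) (laplace_pdf 0 1).

(** The terms outside [A] are replaced by 0, so that the independence of the whole
family applies. *)
Lemma integral_expR_sum_le (A : {set I}) (h : R -> R) (c : R) :
  measurable_fun setT h ->
  (\int[@lebesgue_measure R]_x (expR (h x) * laplace_pdf 0 1 x)%:E <= (expR c)%:E)%E ->
  (\int[P]_w (expR (\sum_(i in A) h (Y i w)))%:E <= (expR (#|A|%:R * c))%:E)%E.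
Proof.
move=> mh; set J := (\int[_]_x _)%E => hc.
have J0 : (0 <= J)%E.
  by apply: integral_ge0 => x _; rewrite lee_fin mulr_ge0 ?expR_ge0 ?laplace_pdf_ge0.
have JE : J = (fine J)%:E.
  by rewrite fineK// ge0_fin_numE//; exact: le_lt_trans hc (ltry _).
pose g i y : R := if i \in A then h y else 0.
have gE i : (\int[P]_w (expR (g i (Y i w)))%:E = (if i \in A then fine J else 1)%:E)%E.
  rewrite /g; case: ifP => iA.
    rewrite -JE (@integral_density _ _ _ _ _ _ (fun y => expR (h y)) (lapY i))//.
    - exact: measurable_laplace_pdf.
    - by move=> x; exact: laplace_pdf_ge0.
    - exact: measurableT_comp.
  by rewrite expR0 integral_cst// mul1e; exact: probability_setT.
have mg i : measurable_fun setT (g i) by rewrite /g; case: (i \in A).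
rewrite (_ : \int[P]_w _ = \int[P]_w (expR (\sum_i g i (Y i w)))%:E)%E; last first.
  by under eq_integral do rewrite big_mkcond/=.
rewrite (integral_expR_sum_independent indY mg gE) lee_fin -big_mkcond/=.
rewrite prodr_const expRM_natl lerXn2r ?nnegrE ?fine_ge0 ?expR_ge0//.
by rewrite -lee_fin -JE.
Qed.

End laplace_noise.

(** * Stability of the estimates and of the scores *)

Section loglik_perturbation.
Context {R : realType}.

Lemma ln_lipschitz (s s' c : R) : 0 < c -> c <= s -> c <= s' ->
  `|ln s' - ln s| <= `|s' - s| / c.
Proof.
move=> c0.
wlog ss' : s s' / s <= s'.
  move=> H cs cs'; have [ss'|/ltW s's] := leP s s'; first exact: H.
  by rewrite distrC (distrC s'); exact: H.
move=> cs cs'; have s0 := lt_le_trans c0 cs; have s0' := lt_le_trans c0 cs'.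
rewrite !ger0_norm ?subr_ge0// ?ler_ln ?posrE//.
rewrite -ln_div ?posrE//.
have -> : s' / s = 1 + (s' - s) / s by rewrite mulrBl divff ?gt_eqF// addrC subrK.
apply: (@le_trans _ _ ((s' - s) / s)).
  by rewrite -ler_expR lnK ?expR_ge1Dx// posrE ltr_wpDr// divr_ge0 ?subr_ge0// ltW.
by rewrite ler_wpM2l ?subr_ge0// lef_pV2 ?posrE.
Qed.

(** The logarithm and the inverse are Lipschitz above [smin / 2], and both
scales stay there because [kappa <= smin / 2]. *)
Lemma laplace_loglik_perturb (m s m' s' x smin kappa : R) : 0 < smin ->
  smin <= s -> `|m' - m| <= kappa -> `|s' - s| <= kappa -> kappa <= smin / 2 ->
  `|laplace_loglik m' s' x - laplace_loglik m s x| <=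
    kappa * (4 / smin + 2 / smin ^+ 2 * `|x - m|).
Proof.
move=> smin0 smins mm ss ks.
have h0 : 0 < smin / 2 by rewrite divr_gt0.
have s0 : 0 < s by exact: lt_le_trans smins.
have k0 : 0 <= kappa by exact: le_trans mm.
have s'h : smin / 2 <= s' by move: ss; rewrite ler_distl => /andP[? ?]; lra.
have s'0 : 0 < s' by exact: lt_le_trans s'h.
have L : `|ln s' - ln s| <= 2 / smin * kappa.
  apply: le_trans (ln_lipschitz h0 _ s'h) _; first lra.
  by rewrite mulrC invfM invrK (mulrC _ 2) ler_wpM2l// divr_ge0// ltW.
have iV : s'^-1 <= 2 / smin.
  by rewrite -[2 / smin]invrK invf_div lef_pV2 ?posrE.
have isV : s^-1 <= smin^-1 by rewrite lef_pV2 ?posrE.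
have A : `| `|x - m'| / s' - `|x - m| / s'| <= 2 / smin * kappa.
  rewrite -mulrBl normrM (@gtr0_norm _ s'^-1) ?invr_gt0// mulrC.
  apply: ler_pM => //; first by rewrite invr_ge0 ltW.
  apply: le_trans mm; apply: le_trans (ler_dist_dist _ _) _.
  by rewrite (_ : x - m' - (x - m) = m - m'); [rewrite distrC|ring].
have B : `| `|x - m| / s' - `|x - m| / s| <= 2 / smin ^+ 2 * `|x - m| * kappa.
  have -> : `|x - m| / s' - `|x - m| / s = `|x - m| * ((s - s') * (s'^-1 * s^-1)).
    by field; rewrite !gt_eqF.
  have -> : 2 / smin ^+ 2 * `|x - m| * kappa =
      `|x - m| * (kappa * (2 / smin * smin^-1)) by rewrite expr2 invfM; ring.
  rewrite normrM normr_id; apply: ler_wpM2l => //.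
  rewrite normrM distrC; apply: ler_pM => //.
  rewrite normrM !gtr0_norm ?invr_gt0//.
  by apply: ler_pM => //; rewrite invr_ge0 ltW.
rewrite /laplace_loglik.
have -> : - ln s' - `|x - m'| / s' - (- ln s - `|x - m| / s) =
  - (ln s' - ln s) - ((`|x - m'| / s' - `|x - m| / s') +
    (`|x - m| / s' - `|x - m| / s)) by ring.
apply: le_trans (ler_normB _ _) _; rewrite normrN.
apply: le_trans (lerD L (le_trans (ler_normD _ _) (lerD A B))) _.
by rewrite le_eqVlt; apply/orP; left; apply/eqP; ring.
Qed.

End loglik_perturbation.

(** The comprehension in [hamming] is a classical set; cardinalities of subsets
of a finite type need the boolean one. *)
Lemma hammingE (n k : nat) (z z' : {ffun 'I_n -> 'I_k}) :
  hamming z z' = #|[set i | z i != z' i]%SET|.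
Proof.
by apply: eq_card => i; rewrite !inE; apply/idP/idP => [/set_mem|/mem_set].
Qed.

Section stability.
Context {R : realType} (n d k : nat).
Variables (zs : {ffun 'I_n -> 'I_k}) (mu sg : 'I_k -> 'I_d -> R).
Variables (e X : 'I_n -> 'I_d -> R).
Hypothesis XE : forall i l, X i l = mu (zs i) l + sg (zs i) l * e i l.
Variables (smin smax alpha eta D nu : R).
Hypotheses (smin0 : 0 < smin) (alpha0 : 0 < alpha) (eta0 : 0 <= eta)
  (nu0 : 0 < nu) (D1 : 1 <= D).
Hypothesis sgB : forall a l, smin <= sg a l <= smax.
Hypothesis muD : forall a b l, `|mu a l - mu b l| <= D.
Hypothesis class_large : forall a, alpha * nu <= #|label_class zs a|%:R.
Hypothesis noise_mean : forall a l,
  `|\sum_(i in label_class zs a) e i l| <= eta * #|label_class zs a|%:R.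
Hypothesis noise_abs : forall a l,
  `|\sum_(i in label_class zs a) (`|e i l| - 1)| <= eta * #|label_class zs a|%:R.
Hypothesis noise_tail : forall l,
  \sum_i Num.max (`|e i l| - D) 0 <= eta * nu.
Variable z : {ffun 'I_n -> 'I_k}.
Hypothesis zs_z : (hamming zs z)%:R * D <= eta * nu.

Let mistakes : {set 'I_n} := [set i | zs i != z i]%SET.

Let mistakes_le : #|mistakes|%:R * D <= eta * nu.
Proof. by rewrite -hammingE. Qed.

Let card_mistakes_le : #|mistakes|%:R <= eta * nu.
Proof.
by apply: le_trans mistakes_le; rewrite -[leLHS]mulr1; apply: ler_wpM2l.
Qed.

Let sum_class_dist a (u : 'I_n -> R) :
  `|\sum_(i in label_class z a) u i - \sum_(i in label_class zs a) u i| <=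
  \sum_(i in mistakes) `|u i|.
Proof.
rewrite [X in `|X - _|]big_mkcond [X in `|_ - X|]big_mkcond -sumrB/=.
apply: le_trans (ler_norm_sum _ _ _) _; rewrite [leRHS]big_mkcond/=.
apply: ler_sum => i _; rewrite !inE.
have [<-|_] := eqVneq (zs i) (z i); first by rewrite subrr normr0.
by case: ifP; case: ifP => _ _; rewrite ?subrr ?subr0 ?sub0r ?normrN ?normr0.
Qed.

Let sum_mistakes_abs l : \sum_(i in mistakes) `|e i l| <= 2 * eta * nu.
Proof.
apply: (@le_trans _ _ (\sum_(i in mistakes) (D + Num.max (`|e i l| - D) 0))).
  by apply: ler_sum => i _; rewrite maxEle; case: ifP => //; lra.
rewrite big_split/= sumr_const -[_ *+ #|_|]mulr_natl -mulrA mulr2n mulrDl mul1r.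
apply: lerD; first exact: mistakes_le.
apply: le_trans (noise_tail l); rewrite big_mkcond/=; apply: ler_sum => i _.
by case: ifP => // _; rewrite le_max lexx orbT.
Qed.

Let smax0 (a : 'I_k) (l : 'I_d) : 0 < smax.
Proof.
by have /andP[h1 h2] := sgB a l; exact: lt_le_trans smin0 (le_trans h1 h2).
Qed.

Hypothesis eta_alpha : eta <= alpha / 2.

Let card_class a : #|label_class zs a|%:R <= 2 * #|label_class z a|%:R :> R.
Proof.
have := sum_class_dist a (fun=> 1).
under [X in _ <= X -> _]eq_bigr do rewrite normr1.
rewrite !sumr_const ler_distl => /andP[+ _].
have mS := card_mistakes_le.
have := class_large a.
have : eta * nu <= alpha / 2 * nu by rewrite ler_wpM2r// ltW.
by lra.
Qed.

Let K1 : R := 2 * smax + 2 * (1 + 3 * smax) / alpha.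

(** The sum over the estimated cluster differs from the one over the true cluster
by terms at misplaced points, whose total is at most [eta * nu * (1 + 3 * smax)]. *)
Let mean_class_le a (l : 'I_d) (u : 'I_n -> R) :
  (forall i, `|u i| <= D + smax * (1 + `|e i l|)) ->
  `|\sum_(i in label_class zs a) u i| <= smax * (eta * #|label_class zs a|%:R) ->
  `|\sum_(i in label_class z a) u i| <= eta * K1 * #|label_class z a|%:R.
Proof.
move=> uD usum; have s0 := smax0 a l.
have cz := card_class a; have cl := class_large a.
have H : \sum_(i in mistakes) `|u i| <= eta * nu * (1 + 3 * smax).
  apply: (@le_trans _ _ (\sum_(i in mistakes) (D + smax + smax * `|e i l|))).
    by apply: ler_sum => i _; apply: le_trans (uD i) _; rewrite mulrDr mulr1 addrA.
  rewrite big_split/= sumr_const -[_ *+ #|_|]mulr_natl -mulr_sumr.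
  have := sum_mistakes_abs l.
  have mS := card_mistakes_le.
  have hD := mistakes_le.
  have := ler_wpM2l (ltW s0) mS.
  by move=> ? /(ler_wpM2l (ltW s0)); lra.
have B : `|\sum_(i in label_class z a) u i| <=
    `|\sum_(i in label_class zs a) u i| + \sum_(i in mistakes) `|u i|.
  have := sum_class_dist a u; rewrite -lerBlDl => B; apply: le_trans B.
  exact: lerB_dist.
apply: le_trans B _; apply: le_trans (lerD usum H) _.
have nuz : nu <= 2 * #|label_class z a|%:R / alpha.
  by rewrite ler_pdivlMr// mulrC; exact: le_trans cz.
apply: (@le_trans _ _ (smax * (eta * (2 * #|label_class z a|%:R)) +
   eta * (2 * #|label_class z a|%:R / alpha) * (1 + 3 * smax))).
  apply: lerD; first by rewrite ler_wpM2l ?(ltW s0)// ler_wpM2l.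
  rewrite ler_wpM2r ?ler_wpM2l//; have := s0; lra.
by rewrite /K1 le_eqVlt; apply/orP; left; apply/eqP; ring.
Qed.

Let obs_dist i a l : `|X i l - mu a l| <= D + smax * `|e i l|.
Proof.
rewrite XE addrAC; apply: le_trans (ler_normD _ _) _; apply: lerD => //.
have /andP[h1 h2] := sgB (zs i) l.
by rewrite normrM ger0_norm ?ler_wpM2r// (le_trans (ltW smin0)).
Qed.

Let card_z0 a : 0 < #|label_class z a|%:R :> R.
Proof. have := mulr_gt0 alpha0 nu0; have := card_class a; have := class_large a.
by lra. Qed.

Lemma mu_hat_close a l : `|mu_hat X z a l - mu a l| <= eta * K1.
Proof.
have c0 := card_z0 a; have s0 := smax0 a l.
have -> : mu_hat X z a l - mu a l =
    #|label_class z a|%:R^-1 * \sum_(i in label_class z a) (X i l - mu a l).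
  rewrite sumrB mulrBr sumr_const -[X in _ - _ * X]mulr_natl mulrA.
  by rewrite mulVf ?gt_eqF// mul1r.
rewrite normrM ger0_norm ?invr_ge0 ?(ltW c0)// mulrC ler_pdivrMr//.
apply: (mean_class_le (l := l)).
  move=> i; apply: le_trans (obs_dist i a l) _.
  by rewrite lerD2l ler_wpM2l ?(ltW s0)// lerDr.
rewrite (eq_bigr (fun i => sg a l * e i l)); last first.
  by move=> i; rewrite inE => /eqP za; rewrite XE za addrAC subrr add0r.
rewrite -mulr_sumr normrM; have /andP[h1 h2] := sgB a l.
rewrite ger0_norm; first by apply: ler_pM => //; exact: le_trans (ltW smin0) h1.
exact: le_trans (ltW smin0) h1.
Qed.

Lemma sigma_hat_close a l : `|sigma_hat X z a l - sg a l| <= 2 * eta * K1.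
Proof.
have c0 := card_z0 a; have s0 := smax0 a l.
have /andP[h1 h2] := sgB a l; have sm0 := smin0.
have -> : sigma_hat X z a l - sg a l = #|label_class z a|%:R^-1 *
    (\sum_(i in label_class z a) (`|X i l - mu_hat X z a l| - `|X i l - mu a l|) +
     \sum_(i in label_class z a) (`|X i l - mu a l| - sg a l)).
  rewrite -big_split/=.
  under [X in _ = _ * X]eq_bigr do rewrite addrA subrK.
  rewrite sumrB mulrBr sumr_const -[X in _ - _ * X]mulr_natl mulrA.
  by rewrite mulVf ?gt_eqF// mul1r.
rewrite normrM ger0_norm ?invr_ge0 ?(ltW c0)// mulrC ler_pdivrMr//.
have -> : 2 * eta * K1 * #|label_class z a|%:R =
  eta * K1 * #|label_class z a|%:R + eta * K1 * #|label_class z a|%:R by ring.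
apply: le_trans (ler_normD _ _) _; apply: lerD.
  apply: le_trans (ler_norm_sum _ _ _) _.
  rewrite mulr_natr -sumr_const; apply: ler_sum => i _.
  apply: le_trans (mu_hat_close a l); apply: le_trans (ler_dist_dist _ _) _.
  rewrite (_ : _ - _ - (_ - _) = mu a l - mu_hat X z a l); last by ring.
  by rewrite distrC.
apply: (mean_class_le (l := l)).
  move=> i; apply: le_trans (ler_normB _ _) _; rewrite normr_id.
  rewrite (ger0_norm (x := sg a l)); last lra.
  by apply: le_trans (lerD (obs_dist i a l) h2) _; lra.
rewrite (eq_bigr (fun i => sg a l * (`|e i l| - 1))); last first.
  move=> i; rewrite inE => /eqP za; rewrite XE za addrAC subrr add0r.
  by rewrite normrM ger0_norm; [ring|lra].
rewrite -mulr_sumr normrM ger0_norm; last lra.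
by apply: ler_pM => //; lra.
Qed.

Let K2 : R := 4 / smin + 2 / smin ^+ 2 + 2 / smin ^+ 2 * smax.

Lemma score_close i a : 2 * eta * K1 <= smin / 2 ->
  `|laplace_score X z i a - \sum_(l < d) laplace_loglik (mu a l) (sg a l) (X i l)|
  <= 2 * eta * K1 * K2 * \sum_(l < d) (D + `|e i l|).
Proof.
move=> small; rewrite /laplace_score -sumrB mulr_sumr.
apply: le_trans (ler_norm_sum _ _ _) _; apply: ler_sum => l _.
have /andP[h1 h2] := sgB a l.
have mu1 : `|mu_hat X z a l - mu a l| <= 2 * eta * K1.
  have := mu_hat_close a l; have := normr_ge0 (mu_hat X z a l - mu a l).
  lra.
have K0 : 0 <= 2 * eta * K1 by exact: le_trans mu1.
apply: le_trans
  (laplace_loglik_perturb (X i l) smin0 h1 mu1 (sigma_hat_close a l) small) _.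
rewrite -[leRHS]mulrA; apply: ler_wpM2l => //.
have s20 : 0 <= 2 / smin ^+ 2 by rewrite divr_ge0// sqr_ge0.
have s40 : 0 <= 4 / smin by rewrite divr_ge0// ltW.
have := ler_wpM2l s20 (obs_dist i a l).
have s0 := ltW (smax0 a l).
have e0 := normr_ge0 (e i l).
have : 0 <= 2 / smin ^+ 2 * smax by rewrite mulr_ge0.
rewrite /K2; move: (2 / smin ^+ 2) (4 / smin) s20 s40 (`|X i l - _|) => p q p0 q0 y.
by have := D1; nra.
Qed.

(** The conclusion does not mention [z]: whichever labelling of the neighbourhood
the estimates come from, the observation [i] satisfies the same inequality. *)
Lemma mistake_loglik i b : 2 * eta * K1 <= smin / 2 ->
  laplace_score X z i (zs i) <= laplace_score X z i b ->
  - (4 * eta * K1 * K2 * \sum_(l < d) (D + `|e i l|)) <=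
  \sum_(l < d) (laplace_loglik (mu b l) (sg b l) (X i l) -
                laplace_loglik (mu (zs i) l) (sg (zs i) l) (X i l)).
Proof.
move=> small sc; rewrite sumrB.
have := score_close i b small; have := score_close i (zs i) small.
by rewrite !ler_distl => /andP[? ?] /andP[? ?]; lra.
Qed.

End stability.

(** * Relabelling, exponential moments and Markov bounds *)

Section relabelling.
Context {R : realType} (n d k : nat).
Implicit Types (X : 'I_n -> 'I_d -> R) (z : {ffun 'I_n -> 'I_k}).

Definition relabel (tau : {perm 'I_k}) z : {ffun 'I_n -> 'I_k} :=
  [ffun i => tau (z i)].

Lemma label_class_relabel tau z a :
  label_class (relabel tau z) (tau a) = label_class z a.
Proof.
by apply/setP => i; rewrite !inE ffunE (inj_eq perm_inj).
Qed.

Lemma laplace_score_relabel X tau z i a :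
  laplace_score X (relabel tau z) i (tau a) = laplace_score X z i a.
Proof.
rewrite /laplace_score; apply: eq_bigr => l _.
have muE : mu_hat X (relabel tau z) (tau a) l = mu_hat X z a l.
  by rewrite /mu_hat label_class_relabel.
have sE : sigma_hat X (relabel tau z) (tau a) l = sigma_hat X z a l.
  by rewrite /sigma_hat label_class_relabel muE.
by rewrite muE sE.
Qed.

(** The algorithm commutes with permutations of the labels, so that one may assume
that the permutation realising the initial loss is the identity. *)
Lemma iterates_relabel X tau (zhat : nat -> {ffun 'I_n -> 'I_k}) :
  iterates X zhat -> iterates X (fun t => relabel tau (zhat t)).
Proof.
move=> it t i b; rewrite -(permKV tau b) ffunE !laplace_score_relabel.
exact: it.
Qed.

Lemma loss_le_hamming z z' tau : (loss z z' <= hamming z (relabel tau z'))%N.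
Proof.
rewrite /loss; have : tau \in index_enum {perm 'I_k} by exact: mem_index_enum.
elim: (index_enum _) => // x s IH; rewrite in_cons big_cons geq_min.
by move=> /predU1P[->|/IH ->]; rewrite ?leqnn ?orbT.
Qed.

Lemma hamming_attains_loss z z' :
  exists tau, (hamming z (relabel tau z') <= loss z z')%N.
Proof.
rewrite /loss; elim/big_ind : _.
- exists 1%g; rewrite hammingE; apply: leq_trans (max_card _) _.
  by rewrite card_ord.
- move=> x y [t1 h1] [t2 h2]; rewrite /minn; case: ifP => _; by [exists t1|exists t2].
- by move=> tau _; exists tau.
Qed.

End relabelling.

Section exponential_moments.
Context {R : realType}.
Local Notation mu := (@lebesgue_measure R).

Lemma integral_expR_shift (h : R -> R) (c : R) : measurable_fun setT h ->
  (\int[mu]_x (expR (h x + c) * laplace_pdf 0 1 x)%:E =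
   (expR c)%:E * \int[mu]_x (expR (h x) * laplace_pdf 0 1 x)%:E)%E.
Proof.
move=> mh; rewrite -ge0_integralZl_EFin ?expR_ge0//; last 2 first.
- by move=> x _; rewrite lee_fin mulr_ge0 ?expR_ge0 ?laplace_pdf_ge0.
- apply/measurable_EFinP/measurable_funM; last exact: measurable_laplace_pdf.
  exact: measurableT_comp.
by apply: eq_integral => x _; rewrite -EFinM expRD -mulrA mulrCA.
Qed.

(** Since [(1 - t) * (1 + t + 2 * t ^ 2) = 1 + t ^ 2 - 2 * t ^ 3 >= 1]. *)
Lemma inv_le_expR (t : R) : `|t| <= 2^-1 -> (1 - t)^-1 <= expR (t + 2 * t ^+ 2).
Proof.
rewrite ler_norml => /andP[t1 t2].
apply: le_trans (expR_ge1Dx _); rewrite -div1r ler_pdivrMr; last lra.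
nra.
Qed.

(** The four deviations to control in a cluster: both signs of the mean of the
noise and of the centred mean of its absolute value. *)
Definition signed_noise (linear s : bool) (x : R) : R :=
  (-1) ^+ s * (if linear then x else `|x| - 1).

Lemma measurable_signed_noise b s : measurable_fun setT (signed_noise b s).
Proof.
apply: measurable_funM => //; case: b => //.
by apply: measurable_funB => //; exact: measurableT_comp.
Qed.

(** Both variables are centred, so their exponential moments are of second order
in [t]. *)
Lemma signed_noise_mgf (b s : bool) (t : R) : 0 <= t <= 2^-1 ->
  (\int[mu]_x (expR (t * signed_noise b s x) * laplace_pdf 0 1 x)%:E
    <= (expR (2 * t ^+ 2))%:E)%E.
Proof.
move=> /andP[t0 t2].
pose u := (-1) ^+ s * t.
have un : `|u| <= 2^-1 by rewrite normrM normrX normrN1 expr1n mul1r ger0_norm.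
have u2 : u ^+ 2 = t ^+ 2 by rewrite exprMn sqrr_sign mul1r.
case: b; rewrite /signed_noise.
  have E x : t * ((-1) ^+ s * x) = u * x by rewrite mulrA (mulrC t).
  under eq_integral do rewrite E.
  rewrite laplace_mgf; last by apply: le_lt_trans un _; lra.
  rewrite lee_fin u2; apply: le_trans (inv_le_expR _) _.
    by rewrite ger0_norm ?sqr_ge0//; nra.
  have q1 : t ^+ 2 <= 2^-1 by nra.
  by rewrite ler_expR; have := sqr_ge0 t; move: (t ^+ 2) q1 => q; nra.
have E x : t * ((-1) ^+ s * (`|x| - 1)) = u * `|x| - u.
  by rewrite mulrA (mulrC t) -/u mulrBr mulr1.
under eq_integral do rewrite E.
rewrite (@integral_expR_shift (fun x => u * `|x|)); last first.
  by apply: measurable_funM => //; exact: measurableT_comp.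
have u1 : u < 1 by apply: le_lt_trans (ler_norm u) _; apply: le_lt_trans un _; lra.
rewrite laplace_abs_mgf// -EFinM lee_fin.
apply: le_trans (ler_wpM2l (expR_ge0 _) (inv_le_expR un)) _.
by rewrite -expRD u2 addrA addNr add0r.
Qed.

Lemma half_abs_mgf :
  (\int[mu]_x (expR (2^-1 * `|x|) * laplace_pdf 0 1 x)%:E <= (expR 1)%:E)%E.
Proof.
rewrite laplace_abs_mgf ?lee_fin; last lra.
by apply: le_trans (expR_ge1Dx _); rewrite -div1r ler_pdivrMr; lra.
Qed.

(** By [exp (max u 0) <= 1 + exp u]. The exponential smallness in [D] is what
makes the total excess small uniformly over the misplaced points. *)
Lemma half_excess_mgf (D : R) :
  (\int[mu]_x (expR (2^-1 * Num.max (`|x| - D) 0) * laplace_pdf 0 1 x)%:E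
    <= (expR (2 * expR (- (2^-1 * D))))%:E)%E.
Proof.
have mabs : measurable_fun setT (fun x : R => 2^-1 * `|x|).
  by apply: measurable_funM => //; exact: measurableT_comp.
have ml := @measurable_laplace_pdf R 0 1.
apply: (@le_trans _ _ (\int[mu]_x ((laplace_pdf 0 1 x)%:E +
    (expR (2^-1 * `|x| + - (2^-1 * D)) * laplace_pdf 0 1 x)%:E))%E).
  apply: ge0_le_integral => //.
  - by move=> x _; rewrite lee_fin mulr_ge0 ?expR_ge0 ?laplace_pdf_ge0.
  - apply/measurable_EFinP/measurable_funM => //; apply: measurableT_comp => //.
    apply: measurable_funM => //; apply: measurable_maxr => //.
    by apply: measurable_funB => //; exact: measurableT_comp.
  - apply: emeasurable_funD; apply/measurable_EFinP => //.
    apply: measurable_funM => //; apply: measurableT_comp => //.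
    exact: measurable_funD.
  - move=> x _; rewrite -EFinD lee_fin -{2}(mul1r (laplace_pdf 0 1 x)) -mulrDl.
    apply: ler_wpM2r; first exact: laplace_pdf_ge0.
    rewrite -mulrBr maxEle; case: ifP => _.
      by rewrite mulr0 expR0 lerDl expR_ge0.
    by rewrite lerDr.
rewrite ge0_integralD//; last 4 first.
- by move=> x _; rewrite lee_fin laplace_pdf_ge0.
- exact/measurable_EFinP.
- by move=> x _; rewrite lee_fin mulr_ge0 ?expR_ge0 ?laplace_pdf_ge0.
- apply/measurable_EFinP/measurable_funM => //; apply: measurableT_comp => //.
  exact: measurable_funD.
rewrite integral_laplace_pdf// (@integral_expR_shift (fun x => 2^-1 * `|x|))//.
rewrite laplace_abs_mgf; last lra.
rewrite -EFinM -EFinD lee_fin; apply: le_trans (expR_ge1Dx _).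
rewrite lerD2l (_ : 1 - 2^-1 = 2^-1 :> R); last lra.
by rewrite invrK mulrC.
Qed.

End exponential_moments.

Section markov.
Context {R : realType} dT (T : measurableType dT) (P : probability T R).

(** On the event that the sum of the [F j] is at most 1, each of them is. A
single application of the inequality of Markov replaces a union bound, and each
deviation bound takes the form [exp (deviation - threshold) <= 1]. *)
Lemma markov_family (J : finType) (F : J -> T -> R) (b : R) :
  (forall j, measurable_fun setT (F j)) -> (forall j w, 0 <= F j w) ->
  (\sum_j \int[P]_w (F j w)%:E <= b%:E)%E ->
  exists E : set T, [/\ measurable E, ((1 - b)%:E <= P E)%E &
    forall w, E w -> forall j, F j w <= 1].
Proof.
move=> mF F0 Fb; pose Phi w : R := \sum_j F j w.
have mPhi : measurable_fun setT Phi by exact: measurable_sum.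
have Phi0 w : 0 <= Phi w by exact: sumr_ge0.
pose E := [set w | Phi w <= 1].
have mE : measurable E.
  rewrite (_ : E = setT `&` Phi @^-1` `]-oo, 1]); last first.
    by apply/seteqP; split => w; rewrite /E/= in_itv/=; [|case].
  exact: mPhi.
exists E; split => //; last first.
  move=> w Ew j; apply: le_trans Ew; rewrite /Phi (bigD1 j)//= lerDl.
  exact: sumr_ge0.
have PC : (P (~` E) <= b%:E)%E.
  apply: le_trans Fb; rewrite -ge0_integral_sum//; last 2 first.
  - by move=> j; exact/measurable_EFinP.
  - by move=> j w _; rewrite lee_fin.
  rewrite -[~` E]setIT -integral_indic//; last exact: measurableC.
  apply: ge0_le_integral => //.
  - by apply/measurable_EFinP/measurable_indic; exact: measurableC.
  - by apply: emeasurable_sum => j; exact/measurable_EFinP.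
  - move=> w _; rewrite sumEFin lee_fin indicE -/(Phi w).
    case: (boolP (w \in _)) => //; rewrite inE/= => /negP.
    by rewrite -ltNge => /ltW.
move: PC; have -> : P (~` E) = (1 - P E)%E by exact: probability_setC.
have fE : P E \is a fin_num by exact: fin_num_measure.
by rewrite -(fineK fE) -EFinB !lee_fin; lra.
Qed.

Lemma probability_setI_ge (A B : set T) (a b : R) :
  measurable A -> measurable B ->
  ((1 - a)%:E <= P A)%E -> ((1 - b)%:E <= P B)%E ->
  ((1 - (a + b))%:E <= P (A `&` B))%E.
Proof.
move=> mA mB PA PB.
have mI := measurableI _ _ mA mB.
have : (P (~` (A `&` B)) <= P (~` A) + P (~` B))%E.
  by rewrite setCI; apply: measureU2; exact: measurableC.
have -> : P (~` (A `&` B)) = (1 - P (A `&` B))%E by exact: probability_setC.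
have -> : P (~` A) = (1 - P A)%E by exact: probability_setC.
have -> : P (~` B) = (1 - P B)%E by exact: probability_setC.
have fA : P A \is a fin_num by exact: fin_num_measure.
have fB : P B \is a fin_num by exact: fin_num_measure.
have fI : P (A `&` B) \is a fin_num by exact: fin_num_measure.
move: PA PB; rewrite -(fineK fA) -(fineK fB) -(fineK fI) -!EFinB -EFinD !lee_fin.
lra.
Qed.

End markov.

(** * The favourable events *)

Section good_events.
Context {R : realType} dT (T : measurableType dT) (P : probability T R).
Context (n d k : nat) (eps : 'I_n * 'I_d -> {RV P >-> R}).
Hypothesis eps_indep : mutually_independent eps.
Hypothesis eps_lap : forall il, has_density (eps il) (laplace_pdf 0 1).
Variable zs : {ffun 'I_n -> 'I_k}.

Let column_indep l : mutually_independent (fun i => eps (i, l)).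
Proof. by apply: mutually_independent_comp => // i j [->]. Qed.

Let row_indep i : mutually_independent (fun l => eps (i, l)).
Proof. by apply: mutually_independent_comp => // l m [->]. Qed.

Let measurable_expR_sum (I : finType) (A : {set I}) (Y : I -> {RV P >-> R})
    (h : R -> R) : measurable_fun setT h ->
  measurable_fun setT (fun w => expR (\sum_(i in A) h (Y i w))).
Proof.
move=> mh; apply: measurableT_comp => //.
under eq_fun do rewrite -big_filter.
by apply: measurable_sum => i; exact: (measurableT_comp mh).
Qed.

Let integral_expRZ (f : T -> R) (c b : R) : measurable_fun setT f ->
  (\int[P]_w (expR (f w))%:E <= (expR b)%:E)%E ->
  (\int[P]_w (expR c * expR (f w))%:E <= (expR (c + b))%:E)%E.
Proof.
move=> mf fb; under eq_integral do rewrite EFinM.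
rewrite ge0_integralZl_EFin ?expR_ge0//; last first.
  by apply/measurable_EFinP; exact: measurableT_comp.
by rewrite expRD EFinM lee_wpmul2l// lee_fin expR_ge0.
Qed.

(** Chernoff bound with the parameter [t = eta / 4], which minimises
[2 * t ^ 2 - t * eta]; the factor 4 counts the two signs of the two statistics. *)
Lemma class_averages_event (eta N : R) : 0 < eta <= 1 ->
  (forall a, N <= #|label_class zs a|%:R) ->
  exists E : set T, [/\ measurable E,
    ((1 - (4 * (d * k))%:R * expR (- (N * eta ^+ 2 / 8)))%:E <= P E)%E &
    forall w, E w -> forall a l,
     `|\sum_(i in label_class zs a) eps (i, l) w| <= eta * #|label_class zs a|%:R /\
     `|\sum_(i in label_class zs a) (`|eps (i, l) w| - 1)| <=
       eta * #|label_class zs a|%:R].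
Proof.
move=> /andP[eta0 eta1] NN; pose t := eta / 4.
have t0 : 0 <= t <= 2^-1 by rewrite /t; lra.
pose h b s x : R := t * signed_noise b s x.
have mh b s : measurable_fun setT (h b s).
  by apply: measurable_funM => //; exact: measurable_signed_noise.
pose S (j : 'I_k * 'I_d * (bool * bool)) w : R :=
  \sum_(i in label_class zs j.1.1) h j.2.1 j.2.2 (eps (i, j.1.2) w).
pose F j w : R := expR (- (t * eta * #|label_class zs j.1.1|%:R)) * expR (S j w).
have [|||E [mE PE EF]] := @markov_family R dT T P _ F
   ((4 * (d * k))%:R * expR (- (N * eta ^+ 2 / 8))).
- move=> j; apply: measurable_funM => //.
  exact: (@measurable_expR_sum _ _ (fun i => eps (i, j.1.2))).
- by move=> j w; rewrite mulr_ge0 ?expR_ge0.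
- have -> : ((4 * (d * k))%:R * expR (- (N * eta ^+ 2 / 8)))%:E =
    (\sum_(j : 'I_k * 'I_d * (bool * bool)) (expR (- (N * eta ^+ 2 / 8)))%:E)%E.
    rewrite sumEFin sumr_const card_prod card_prod card_prod !card_ord card_bool.
    congr EFin; rewrite -[RHS]mulr_natl; congr (_%:R * _).
    by rewrite mulnC (mulnC d).
  apply: lee_sum => j _.
  have /integral_expRZ H := @integral_expR_sum_le R dT T P _ (fun i => eps (i, j.1.2))
    (column_indep _) (fun i => eps_lap _) (label_class zs j.1.1) _ _ (mh j.2.1 j.2.2)
    (signed_noise_mgf j.2.1 j.2.2 t0).
  apply: le_trans (H _ _) _.
    under eq_fun do rewrite -big_filter.
    by apply: measurable_sum => i; exact: (measurableT_comp (mh _ _)).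
  rewrite lee_fin ler_expR.
  have := NN j.1.1; move: (#|_|%:R) => M NM.
  have : 0 <= eta ^+ 2 / 8 by rewrite divr_ge0// sqr_ge0.
  by rewrite /t; nra.
exists E; split => // w Ew a l.
have key b s : \sum_(i in label_class zs a) signed_noise b s (eps (i, l) w)
    <= eta * #|label_class zs a|%:R.
  have := EF w Ew (a, l, (b, s)); rewrite /F/= -expRD -{2}expR0 ler_expR.
  rewrite /S/= -mulr_sumr -mulrA -mulrN -mulrDr addrC.
  have t_gt0 : 0 < t by rewrite /t divr_gt0.
  by rewrite pmulr_rle0// subr_le0.
split.
  have := key true false; have := key true true.
  rewrite /signed_noise expr0 expr1 -!mulr_sumr mul1r mulN1r => h1 h2.
  by rewrite ler_norml; apply/andP; split; lra.
have := key false false; have := key false true.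
rewrite /signed_noise expr0 expr1 -!mulr_sumr mul1r mulN1r => h1 h2.
by rewrite ler_norml; apply/andP; split; lra.
Qed.


(** The exponential moment of order [1/2] of the total excess is at most
[exp (n * 2 * exp (- D / 2))], to be compared with [exp (eta * nu / 2)]. *)
Lemma tail_event (eta nu D : R) :
  exists E : set T, [/\ measurable E,
    ((1 - d%:R * expR (n%:R * (2 * expR (- (2^-1 * D))) - 2^-1 * (eta * nu)))%:E
      <= P E)%E &
    forall w, E w -> forall l,
      \sum_i Num.max (`|eps (i, l) w| - D) 0 <= eta * nu].
Proof.
pose h (x : R) : R := 2^-1 * Num.max (`|x| - D) 0.
have mh : measurable_fun setT h.
  apply: measurable_funM => //; apply: measurable_maxr => //.
  by apply: measurable_funB => //; exact: measurableT_comp.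
pose F l w : R := expR (- (2^-1 * (eta * nu))) *
  expR (\sum_(i in [set: 'I_n]%SET) h (eps (i, l) w)).
have mS l : measurable_fun setT
    (fun w => \sum_(i in [set: 'I_n]%SET) h (eps (i, l) w)).
  under eq_fun do rewrite -big_filter.
  by apply: measurable_sum => i; exact: (measurableT_comp mh).
set b := n%:R * _ - _.
have [|||E [mE PE EF]] := @markov_family R dT T P _ F (d%:R * expR b).
- by move=> l; apply: measurable_funM => //; exact: measurableT_comp.
- by move=> l w; rewrite mulr_ge0 ?expR_ge0.
- have -> : (d%:R * expR b)%:E = (\sum_(l < d) (expR b)%:E)%E.
    by rewrite sumEFin sumr_const card_ord mulr_natl.
  apply: lee_sum => l _.
  have /integral_expRZ H := @integral_expR_sum_le R dT T P _ (fun i => eps (i, l))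
    (column_indep l) (fun i => eps_lap _) [set: 'I_n]%SET _ _ mh (half_excess_mgf D).
  apply: le_trans (H _ (mS l)) _.
  by rewrite lee_fin ler_expR cardsT card_ord addrC.
exists E; split => // w Ew l.
have := EF w Ew l; rewrite /F -expRD -{2}expR0 ler_expR -mulr_sumr -mulrN -mulrDr.
under [X in _ * (_ + X) <= _ -> _]eq_bigl do rewrite inE.
by rewrite pmulr_rle0 ?invr_gt0// addrC subr_le0.
Qed.

Section confusion.
Variables (mu sg : 'I_k -> 'I_d -> R) (C rho : R).
Hypothesis sg_gt0 : forall a l, 0 < sg a l.
Hypothesis C_chernoff : forall a b, b != a ->
  (C%:E <= Defs.chernoff (laplace_density (mu b) (sg b))
                         (laplace_density (mu a) (sg a)))%E.

Let X w i l : R := mu (zs i) l + sg (zs i) l * eps (i, l) w.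

Definition log_ratio w i b : R :=
  \sum_(l < d) (laplace_loglik (mu b l) (sg b l) (X w i l) -
                laplace_loglik (mu (zs i) l) (sg (zs i) l) (X w i l)).

(** The observations that could be attributed to a wrong class by likelihoods
that are only approximately right. *)
Definition confused w : {set 'I_n} :=
  [set i | (4 * C <= \sum_(l < d) `|eps (i, l) w|) ||
           [exists b, (b != zs i) && (- (rho * C) <= log_ratio w i b)]]%SET.

(** The indicator that [i] is confused is at most [W i + sum_b U i b], where [W]
and [U] are the exponentials of Markov-type bounds for the two ways of being
confused. Markov is then applied to the sum over [i], weighted by [theta]. *)
Lemma confusion_event (theta : R) : 0 < theta -> 0 <= rho -> d%:R <= C ->
  exists E : set T, [/\ measurable E,
    ((1 - n%:R * theta * (expR (- C) + k%:R * expR (1 + rho * C - C)))%:E <= P E)%E &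
    forall w, E w -> theta * #|confused w|%:R <= 1].
Proof.
move=> theta0 rho0 dC; have C0 : 0 <= C by exact: le_trans dC.
have /choice[t tP] (ab : 'I_k * 'I_k) : exists t : R, ab.2 != ab.1 -> 0 < t < 1 /\
    (\int[lebesgue_measure_Rd d]_x
      (laplace_density (mu ab.2) (sg ab.2) x `^ t *
       laplace_density (mu ab.1) (sg ab.1) x `^ (1 - t))%:E < (expR (1 - C))%:E)%E.
  have [_|ba] := eqVneq ab.2 ab.1; first by exists 0.
  by have [t t01 H] := chernoff_exponent (C_chernoff ba); exists t.
pose U i b w : R := expR (rho * C) * expR (t (zs i, b) * log_ratio w i b).
pose W i w : R := expR (- (2 * C)) *
   expR (\sum_(l in [set: 'I_d]%SET) 2^-1 * `|eps (i, l) w|).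
have mlr i b : measurable_fun setT (fun w => log_ratio w i b).
  apply: measurable_sum => l.
  have ml m s : measurable_fun setT (fun w => laplace_loglik m s (X w i l)).
    apply: (@measurableT_comp _ _ _ _ _ _ (laplace_loglik m s)).
      by apply: continuous_measurable_fun; exact: continuous_laplace_loglik.
    by apply: measurable_funD => //; exact: measurable_funM.
  by apply: measurable_funB; exact: ml.
have mU i b : measurable_fun setT (U i b).
  apply: measurable_funM => //; apply: measurableT_comp => //.
  exact: measurable_funM.
have mh : measurable_fun setT (fun x : R => 2^-1 * `|x|).
  by apply: measurable_funM => //; exact: measurableT_comp.
have mSW i : measurable_fun setT
    (fun w => \sum_(l in [set: 'I_d]%SET) 2^-1 * `|eps (i, l) w|).
  under eq_fun do rewrite -big_filter.
  by apply: measurable_sum => l; exact: (measurableT_comp mh).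
have mW i : measurable_fun setT (W i).
  by apply: measurable_funM => //; exact: measurableT_comp.
have U0 i b w : 0 <= U i b w by rewrite mulr_ge0 ?expR_ge0.
have W0 i w : 0 <= W i w by rewrite mulr_ge0 ?expR_ge0.
have intU i b : b != zs i ->
    (\int[P]_w (U i b w)%:E <= (expR (1 + rho * C - C))%:E)%E.
  move=> bi; have [t01 H] := tP (zs i, b) bi.
  rewrite (_ : 1 + rho * C - C = rho * C + (1 - C)); last by ring.
  apply: integral_expRZ; first exact: measurable_funM.
  have := @likelihood_ratio_mgf R d dT T P (fun l => eps (i, l)) (mu b) (sg b)
    (mu (zs i)) (sg (zs i)) (t (zs i, b)) (row_indep i) (fun l => eps_lap _)
    (sg_gt0 b) (sg_gt0 (zs i)) t01.
  by rewrite /log_ratio /X => ->; exact: ltW.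
have intW i : (\int[P]_w (W i w)%:E <= (expR (- C))%:E)%E.
  have /integral_expRZ H := @integral_expR_sum_le R dT T P _ (fun l => eps (i, l))
    (row_indep i) (fun l => eps_lap _) [set: 'I_d]%SET _ _ mh half_abs_mgf.
  apply: le_trans (H _ (mSW i)) _.
  by rewrite lee_fin ler_expR cardsT card_ord mulr1; lra.
pose V i w : R := W i w + \sum_(b | b != zs i) U i b w.
have V0 i w : 0 <= V i w by rewrite addr_ge0// sumr_ge0.
have mV i : measurable_fun setT (V i).
  apply: measurable_funD => //; under eq_fun do rewrite -big_filter.
  exact: measurable_sum.
have intV i : (\int[P]_w (V i w)%:E <=
    (expR (- C) + k%:R * expR (1 + rho * C - C))%:E)%E.
  under eq_integral do rewrite EFinD -sumEFin.
  rewrite ge0_integralD//; last 4 first.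
  - by move=> w _; rewrite lee_fin.
  - exact/measurable_EFinP.
  - by move=> w _; rewrite sumEFin lee_fin sumr_ge0.
  - under eq_fun do rewrite -big_filter.
    by apply: emeasurable_sum => b; exact/measurable_EFinP.
  rewrite EFinD; apply: leeD; first exact: intW.
  under eq_integral do rewrite -big_filter.
  rewrite ge0_integral_sum//; last 2 first.
  - by move=> b; exact/measurable_EFinP.
  - by move=> b w _; rewrite lee_fin.
  rewrite big_filter; apply: (@le_trans _ _
      (\sum_(b | b != zs i) (expR (1 + rho * C - C))%:E)%E).
    by apply: lee_sum => b; exact: intU.
  rewrite sumEFin lee_fin sumr_const -[leLHS]mulr_natl ler_wpM2r ?expR_ge0// ler_nat.
  by apply: leq_trans (max_card _) _; rewrite card_ord.
pose F (_ : 'I_1) w : R := theta * \sum_i V i w.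
set bound := n%:R * theta * _.
have [|||E [mE PE EF]] := @markov_family R dT T P _ F bound.
- by move=> j; rewrite /F; apply: measurable_funM => //; exact: measurable_sum.
- by move=> j w; rewrite /F; rewrite mulr_ge0 ?(ltW theta0)// sumr_ge0.
- rewrite big_ord1 /F.
  under eq_integral do rewrite EFinM -sumEFin.
  rewrite ge0_integralZl_EFin ?(ltW theta0)//; last 2 first.
  - by move=> w _; rewrite sumEFin lee_fin sumr_ge0.
  - by apply: emeasurable_sum => i; exact/measurable_EFinP.
  rewrite ge0_integral_sum//; last 2 first.
  - by move=> i; exact/measurable_EFinP.
  - by move=> i w _; rewrite lee_fin.
  rewrite /bound mulrAC mulrC EFinM lee_wpmul2l ?lee_fin ?(ltW theta0)//.
  apply: (@le_trans _ _ (\sum_(i < n)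
      (expR (- C) + k%:R * expR (1 + rho * C - C))%:E)%E).
    by apply: lee_sum => i _; exact: intV.
  by rewrite sumEFin lee_fin sumr_const card_ord -[leLHS]mulr_natl.
exists E; split => // w Ew; apply: le_trans (EF w Ew ord0).
rewrite /F ler_wpM2l ?(ltW theta0)// -sum1_card natr_sum big_mkcond/=.
apply: ler_sum => i _; case: ifP => //.
rewrite inE => /orP[big|/existsP[b /andP[bi lrb]]].
  rewrite ler_wpDr ?sumr_ge0// /W -expRD -[leLHS]expR0 ler_expR -mulr_sumr.
  under [X in _ + _ * X]eq_bigl do rewrite inE.
  by move: big; lra.
have [/andP[t0 t1] _] := tP (zs i, b) bi.
rewrite ler_wpDl// (bigD1 b)//= ler_wpDr ?sumr_ge0//.
rewrite /U -expRD -[leLHS]expR0 ler_expR.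
have rC : 0 <= rho * C by rewrite mulr_ge0.
move: lrb rC; move: (log_ratio w i b) (rho * C) (t _) t0 t1 => r q s s0 s1 rq q0.
by nra.
Qed.

End confusion.

End good_events.

(** * Recovery for a fixed sample size *)

Section contraction.
Context {R : realType} dT (T : measurableType dT) (P : probability T R).
Context (n d k : nat) (eps : 'I_n * 'I_d -> {RV P >-> R}).
Variables (zs : {ffun 'I_n -> 'I_k}) (mu sg : 'I_k -> 'I_d -> R).

(** Errors of the estimated centres are at most [eta] times this constant, and
those of the scales at most twice as much. *)
Definition estimation_const (smax alpha : R) : R :=
  2 * smax + 2 * (1 + 3 * smax) / alpha.

(** Lipschitz constant of the score of a point in the parameters, relative to the
size [D + |eps|] of its coordinates. *)
Definition score_const (smin smax : R) : R :=
  4 / smin + 2 / smin ^+ 2 + 2 / smin ^+ 2 * smax.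

(** A mislabelled point whose total noise is below [4 * C] has a score error of at
most [rho * C], by the hypothesis on [d * D + 4 * C], so that it is confused by
the second clause of the definition. *)
Lemma mistakes_confused (smin smax alpha eta D nu C rho : R) w
    (X : 'I_n -> 'I_d -> R) (z z' : {ffun 'I_n -> 'I_k}) :
  (forall i l, X i l = mu (zs i) l + sg (zs i) l * eps (i, l) w) ->
  0 < smin -> smin <= smax -> 0 < alpha -> 0 <= eta -> 0 < nu -> 1 <= D ->
  (forall a l, smin <= sg a l <= smax) ->
  (forall a b l, `|mu a l - mu b l| <= D) ->
  (forall a, alpha * nu <= #|label_class zs a|%:R) ->
  (forall a l, `|\sum_(i in label_class zs a) eps (i, l) w|
     <= eta * #|label_class zs a|%:R) ->
  (forall a l, `|\sum_(i in label_class zs a) (`|eps (i, l) w| - 1)| <=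
     eta * #|label_class zs a|%:R) ->
  (forall l, \sum_i Num.max (`|eps (i, l) w| - D) 0 <= eta * nu) ->
  (hamming zs z)%:R * D <= eta * nu ->
  eta <= alpha / 2 -> 2 * eta * estimation_const smax alpha <= smin / 2 ->
  4 * eta * estimation_const smax alpha * score_const smin smax * (d%:R * D + 4 * C)
    <= rho * C ->
  (forall i b, laplace_score X z i b <= laplace_score X z i (z' i)) ->
  (hamming zs z' <= #|confused eps zs mu sg C rho w|)%N.
Proof.
move=> XE smin0 smin_max alpha0 eta0 nu0 D1 sgB muD cl nm na nt zz ea small slack sc.
rewrite hammingE; apply: subset_leq_card; apply/fintype.subsetP => i; rewrite !inE => iz.
have [//|/= few] := leP (4 * C) (\sum_(l < d) `|eps (i, l) w|).
apply/existsP; exists (z' i); rewrite eq_sym iz/=.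
have XB : forall i l,
  X i l = mu (zs i) l + sg (zs i) l * (fun i l => eps (i, l) w) i l by [].
have := mistake_loglik XB smin0 alpha0 eta0 nu0 D1 sgB muD cl nm na nt zz ea small
  (sc i (zs i)).
rewrite -/(estimation_const smax alpha) -/(score_const smin smax) /log_ratio.
under [X in _ <= X -> _]eq_bigr do rewrite !XE.
apply: le_trans; rewrite lerN2; apply: le_trans slack.
have s0 := lt_le_trans smin0 smin_max.
apply: ler_wpM2l.
  have e0 : 0 <= estimation_const smax alpha.
    by rewrite addr_ge0 ?divr_ge0 ?mulr_ge0 ?addr_ge0 ?mulr_ge0 ?(ltW s0) ?(ltW alpha0).
  have i20 : 0 <= 2 / smin ^+ 2 by rewrite divr_ge0// sqr_ge0.
  have f0 : 0 <= score_const smin smax.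
    by rewrite !addr_ge0 ?divr_ge0 ?(ltW smin0)// mulr_ge0// ltW.
  by rewrite !mulr_ge0.
rewrite big_split/= sumr_const card_ord -[_ *+ d]mulr_natl lerD2l.
exact: ltW.
Qed.

Hypothesis eps_indep : mutually_independent eps.
Hypothesis eps_lap : forall il, has_density (eps il) (laplace_pdf 0 1).

(** The failure probabilities of the three favourable events, in the order class
averages, excesses, confused points. *)
Definition failure_bound (alpha eta D nu C rho : R) : R :=
  (4 * (d * k))%:R * expR (- (alpha * nu * eta ^+ 2 / 8)) +
  d%:R * expR (n%:R * (2 * expR (- (2^-1 * D))) - 2^-1 * (eta * nu)) +
  (expR (- (4 * rho * C)) + k%:R * expR (1 - 3 * rho * C)).

(** The neighbourhood of the truth is stable: from any labelling in it the next
one makes at most as many mistakes as there are confused points, and by the last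
hypothesis on the parameters this leads back to the neighbourhood. *)
Lemma recovery_event (smin smax alpha eta D nu C rho : R)
    (X : T -> 'I_n -> 'I_d -> R) :
  (forall w i l, X w i l = mu (zs i) l + sg (zs i) l * eps (i, l) w) ->
  (0 < n)%N -> 0 < smin -> smin <= smax -> 0 < alpha -> 0 < eta <= 1 -> 0 < nu ->
  1 <= D -> 0 <= rho -> d%:R <= C ->
  (forall a l, smin <= sg a l <= smax) ->
  (forall a b l, `|mu a l - mu b l| <= D) ->
  (forall a, alpha * nu <= #|label_class zs a|%:R) ->
  (forall a b, b != a ->
    (C%:E <= Defs.chernoff (laplace_density (mu b) (sg b))
                           (laplace_density (mu a) (sg a)))%E) ->
  eta <= alpha / 2 -> 2 * eta * estimation_const smax alpha <= smin / 2 ->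
  4 * eta * estimation_const smax alpha * score_const smin smax * (d%:R * D + 4 * C)
    <= rho * C ->
  n%:R * expR (- ((1 - 4 * rho) * C)) * D <= eta * nu ->
  exists E : set T, [/\ measurable E,
    ((1 - failure_bound alpha eta D nu C rho)%:E <= P E)%E &
    forall w, E w -> forall zhat, iterates (X w) zhat ->
      (loss zs (zhat 0%N))%:R * D <= eta * nu ->
      forall t, (0 < t)%N ->
      (loss zs (zhat t))%:R <= n%:R * expR (- ((1 - 4 * rho) * C))].
Proof.
move=> XE n0 smin0 smin_max alpha0 eta01 nu0 D1 rho0 dC sgB muD cl chC ea small
  slack rate; have /andP[eta0 _] := eta01.
have sg0 a l : 0 < sg a l by have /andP[h _] := sgB a l; exact: lt_le_trans h.
have [E1 [mE1 PE1 HE1]] := class_averages_event eps_indep eps_lap eta01 cl.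
have [E2 [mE2 PE2 HE2]] := tail_event eps_indep eps_lap eta nu D.
pose r := expR (- ((1 - 4 * rho) * C)).
(* This weight makes [theta * #|confused| <= 1] the wanted bound. *)
pose theta := (n%:R * r)^-1.
have nr0 : 0 < n%:R * r by rewrite mulr_gt0 ?ltr0n// expR_gt0.
have theta0 : 0 < theta by rewrite invr_gt0.
have [E3 [mE3 PE3 HE3]] := confusion_event eps_indep eps_lap zs sg0 chC theta0 rho0 dC.
exists ((E1 `&` E2) `&` E3); split.
- by apply: measurableI => //; exact: measurableI.
- rewrite /failure_bound; apply: probability_setI_ge => //.
    exact: measurableI.
    exact: probability_setI_ge.
  apply: le_trans PE3; rewrite lee_fin lerD2l lerN2.
  rewrite /theta invfM mulrA mulfV ?pnatr_eq0 -?lt0n// mul1r -expRN opprK.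
  rewrite mulrDr mulrCA -!expRD le_eqVlt; apply/orP; left; apply/eqP.
  by congr (expR _ + _ * expR _); ring.
move=> w [[w1 w2] w3] zhat it h0 t t0.
have few : #|confused eps zs mu sg C rho w|%:R <= n%:R * r.
  by have := HE3 _ w3; rewrite /theta mulrC ler_pdivrMr// mul1r.
(* From here on the truth is compared with the relabelled iterates. *)
have [tau htau] := hamming_attains_loss zs (zhat 0%N).
pose zt s := relabel tau (zhat s).
have itt : iterates (X w) zt by exact: iterates_relabel.
have step s : (hamming zs (zt s))%:R * D <= eta * nu ->
    (hamming zs (zt s.+1))%:R <= n%:R * r.
  move=> hs; apply: le_trans few; rewrite ler_nat.
  apply: (mistakes_confused (X := X w) (z := zt s) (D := D) (nu := nu)
    (eta := eta) (alpha := alpha) (smin := smin) (smax := smax)) => //.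
  - exact: ltW.
  - by move=> a l; have [] := HE1 _ w1 a l.
  - by move=> a l; have [] := HE1 _ w1 a l.
  - exact: HE2.
have close s : (hamming zs (zt s))%:R * D <= eta * nu.
  elim: s => [|s IH].
    by apply: le_trans h0; rewrite ler_wpM2r ?ler_nat// (le_trans ler01).
  by apply: le_trans rate; rewrite ler_wpM2r ?step// (le_trans ler01).
case: t t0 => // t _; apply: le_trans (step t (close t)).
by rewrite ler_nat; exact: loss_le_hamming.
Qed.

End contraction.

(** * The Chernoff divergence of a Laplace family *)

Section chernoff_laplace.
Context {R : realType}.
Local Notation mu := (@lebesgue_measure R).

(** Arithmetic-geometric mean inequality, at [t = 1/2]. *)
Lemma integral_laplace_bhattacharyya_le1 (m1 s1 m2 s2 : R) : 0 < s1 -> 0 < s2 ->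
  (\int[mu]_x (laplace_pdf m1 s1 x `^ 2^-1 * laplace_pdf m2 s2 x `^ (1 - 2^-1))%:E
    <= 1)%E.
Proof.
move=> s10 s20.
have mG (m s r : R) : measurable_fun setT (fun x => laplace_pdf m s x `^ r).
  exact: (measurableT_comp (measurable_powR _) (measurable_laplace_pdf m s)).
have ml (m s : R) : measurable_fun setT (fun x => (2^-1 * laplace_pdf m s x)%:E).
  by apply/measurable_EFinP/measurable_funM => //; exact: measurable_laplace_pdf.
have il (m s : R) : 0 < s -> (\int[mu]_x (2^-1 * laplace_pdf m s x)%:E = (2^-1)%:E)%E.
  move=> s0; under eq_integral do rewrite EFinM.
  rewrite ge0_integralZl_EFin//; last 2 first.
  - by move=> x _; rewrite lee_fin laplace_pdf_ge0.
  - by apply/measurable_EFinP; exact: measurable_laplace_pdf.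
  by rewrite integral_laplace_pdf// mule1.
have -> : (1%E : \bar R) = (\int[mu]_x ((2^-1 * laplace_pdf m1 s1 x)%:E +
                              (2^-1 * laplace_pdf m2 s2 x)%:E))%E.
  rewrite ge0_integralD//; last 4 first.
  - by move=> x _; rewrite lee_fin mulr_ge0 ?laplace_pdf_ge0.
  - exact: ml.
  - by move=> x _; rewrite lee_fin mulr_ge0 ?laplace_pdf_ge0.
  - exact: ml.
  by rewrite !il// -EFinD; congr EFin; lra.
apply: ge0_le_integral => //.
- by move=> x _; rewrite lee_fin mulr_ge0// powR_ge0.
- by apply/measurable_EFinP/measurable_funM; exact: mG.
- by apply: emeasurable_funD; exact: ml.
move=> x _; rewrite -EFinD lee_fin.
have -> : (1 - 2^-1 = 2^-1 :> R) by lra.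
rewrite !powR12_sqrt ?laplace_pdf_ge0//.
have := sqr_sqrtr (laplace_pdf_ge0 m1 x s10).
have := sqr_sqrtr (laplace_pdf_ge0 m2 x s20).
move: (Num.sqrt _) (Num.sqrt _) => a b <- <-.
have := sqr_ge0 (a - b); nra.
Qed.

(** The choice [t = 1/2] gives an integral at most 1. *)
Lemma chernoff_laplace_ge0 (d : nat) (m1 s1 m2 s2 : 'I_d -> R) :
  (forall l, 0 < s1 l) -> (forall l, 0 < s2 l) ->
  (0 <= Defs.chernoff (laplace_density m1 s1) (laplace_density m2 s2))%E.
Proof.
move=> s10 s20; rewrite /Defs.chernoff leeNr oppe0 lne_le0.
have h01 : 0 < (2^-1 : R) < 1 by lra.
apply: ge_ereal_inf; eexists; first by exists 2^-1; [rewrite /= in_itv/=|reflexivity].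
have [c cE ->] := integral_laplace_density_mean m1 m2 s10 s20 h01.
rewrite lee_fin; apply: prodr_ile1 => l _; rewrite -!lee_fin -cE.
rewrite integral_laplace_bhattacharyya_le1// andbT.
by apply: integral_ge0 => x _; rewrite lee_fin mulr_ge0// powR_ge0.
Qed.

Lemma separation_infP (d k : nat) (m : 'I_k -> 'I_d -> R) a b l :
  `|m a l - m b l| <= separation_inf m.
Proof.
have [->|ab] := eqVneq a b.
  by rewrite subrr normr0; exact: bigmax_ge_id.
apply: (@le_trans _ _ (\big[Num.max/0]_(l' < d) `|m a l' - m b l'|)).
  exact: (le_bigmax _ (fun l' => `|m a l' - m b l'|)).
exact: (@le_bigmax_cond _ _ _ 0 (a, b) (fun p : 'I_k * 'I_k => p.1 != p.2)
  (fun p => \big[Num.max/0]_(l' < d) `|m p.1 l' - m p.2 l'|)).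
Qed.

Lemma separation_inf_ge0 (d k : nat) (m : 'I_k -> 'I_d -> R) :
  0 <= separation_inf m.
Proof. exact: bigmax_ge_id. Qed.

(** The minimum over pairs of classes is finite, so that taking its [fine] part
loses nothing. *)
Lemma chernoff_family_laplace (d k : nat) (m s : 'I_k -> 'I_d -> R) (smin smax : R) :
  (2 <= k)%N -> 0 < smin -> (forall a l, smin <= s a l <= smax) ->
  let C := fine (chernoff_family (fun a => laplace_density (m a) (s a))) in
  [/\ 0 <= C,
      C <= d%:R * (separation_inf m / smin + ln (smax / smin)) &
      forall a b, b != a -> (C%:E <=
        Defs.chernoff (laplace_density (m b) (s b)) (laplace_density (m a) (s a)))%E].
Proof.
move=> k2 smin0 sB C; rewrite /C {C}; set M := chernoff_family _.
have s0 a l : 0 < s a l by have /andP[h _] := sB a l; exact: lt_le_trans h.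
have M0 : (0 <= M)%E.
  by apply: le_bigmin => // p _; exact: chernoff_laplace_ge0.
have Mle a b : b != a -> (M <= Defs.chernoff (laplace_density (m b) (s b))
                                   (laplace_density (m a) (s a)))%E.
  by move=> ba; apply: bigmin_inf (b, a) _ _ _ _ _.
have Mub : (M <= (d%:R * (separation_inf m / smin + ln (smax / smin)))%:E)%E.
  pose a0 : 'I_k := Ordinal (ltn_trans (ltn0Sn 0) k2); pose a1 : 'I_k := Ordinal k2.
  apply: le_trans (Mle a0 a1 _) _ => //.
  by apply: chernoff_laplace_le => // l; exact: separation_infP.
have ME : (fine M)%:E = M.
  by rewrite fineK// ge0_fin_numE//; exact: le_lt_trans Mub (ltry _).
split; [exact: fine_ge0|by rewrite -lee_fin ME|].
by move=> a b ba; rewrite ME; exact: Mle.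
Qed.

End chernoff_laplace.

(** * Growth of exponentials and vanishing precisions *)

Section asymptotic_tools.
Context {R : realType}.

Lemma exp_beats_power (a b : R) (m : nat) : 0 < a -> 0 < b ->
  exists x0, forall x, x0 <= x -> x ^+ m * expR (- (a * x)) <= b.
Proof.
move=> a0 b0; pose F : R := m.+1`!%:R.
have F0 : 0 < F by rewrite ltr0n fact_gt0.
exists (1 + F / (a ^+ m.+1 * b)) => x hx.
have am0 : 0 < a ^+ m.+1 by rewrite exprn_gt0.
have q0 : 0 <= F / (a ^+ m.+1 * b) by rewrite divr_ge0 ?ltW// mulr_gt0.
have x0 : 0 < x by lra.
rewrite expRN ler_pdivrMr ?expR_gt0//.
have := @expR_ge1Dxn R (a * x) m (ltW (mulr_gt0 a0 x0)).
rewrite -/F => H; apply: (@le_trans _ _ (b * ((a * x) ^+ m.+1 / F))); last first.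
  by rewrite ler_wpM2l ?(ltW b0)//; apply: le_trans H; rewrite lerDr.
rewrite mulrA ler_pdivlMr// exprMn exprS mulrA.
have : F <= x * (a ^+ m.+1 * b).
  rewrite -ler_pdivrMr ?mulr_gt0//; lra.
have := exprn_gt0 m x0; rewrite exprS [in X in _ -> _ -> _ <= X]exprS.
move: (x ^+ m) (a ^+ m) => p q p0 H2.
have := ler_wpM2l (ltW p0) H2; lra.
Qed.

(** Take for [s n] the infimum of the precisions at which the property holds, plus
[1 / (n + 1)] to be above one of them. *)
Lemma vanishing_precision (A : nat -> R -> Prop) :
  (forall n e e', e <= e' -> A n e -> A n e') ->
  (forall e, 0 < e -> \forall n \near \oo, A n e) ->
  exists s : nat -> R, s n @[n --> \oo] --> 0 /\ \forall n \near \oo, A n (s n).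
Proof.
move=> mono ev.
pose S n := [set e : R | 0 < e /\ A n e].
pose s n : R := inf (S n) + n.+1%:R^-1.
have lb n : has_lbound (S n) by exists 0 => e [e0 _]; exact: ltW.
have sA n : S n !=set0 -> A n (s n) /\ 0 <= s n.
  move=> S0; have i0 : 0 <= inf (S n) by apply: lb_le_inf => // e [/ltW].
  split; last by rewrite addr_ge0.
  have [e [_ Ae] es] : exists2 e, S n e & e < s n.
    by apply: inf_lt => //; rewrite /s ltrDl invr_gt0.
  exact: mono (ltW es) Ae.
exists s; split; last first.
  have := ev 1 ltr01; apply: filterS => n A1.
  by have [|//] := sA n; exists 1.
apply/cvgrPdist_le => e e0; near=> n.
have A1 : A n (e / 2) by near: n; apply: ev; rewrite divr_gt0.
have Sn : S n (e / 2) by split => //; rewrite divr_gt0.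
have [_ s0] := sA n (ex_intro _ _ Sn).
rewrite sub0r normrN ger0_norm// /s.
have : inf (S n) <= e / 2 by exact: ge_inf.
have : n.+1%:R^-1 <= e / 2.
  apply/ltW; near: n.
  exact: (near_infty_natSinv_lt (PosNum (divr_gt0 e0 (ltr0n _ 2)))).
by move=> h1 h2; rewrite (splitr e) addrC lerD.
Unshelve. all: by end_near. Qed.

End asymptotic_tools.

(** * The asymptotic regime *)

Section regime.
Context {R : realType}.
Variables (k d : nat -> nat) (C Delta : nat -> R) (smin L : R).
Hypotheses (hk : forall n, (2 <= k n)%N) (hd : forall n, (1 <= d n)%N).
Hypotheses (smin0 : 0 < smin) (L0 : 0 <= L).
Hypotheses (C0 : forall n, 0 <= C n) (Delta0 : forall n, 0 <= Delta n).
Hypothesis C_le : forall n, C n <= (d n)%:R * (Delta n / smin + L).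
Hypothesis k_small :
  (fun n => (k n)%:R * ln (d n * k n)%:R ^+ 2) =o_\oo (fun n => n%:R : R).
Hypothesis Delta_small : Delta =O_\oo (fun n => (d n)%:R^-1 * C n).
Hypothesis C_large :
  (fun n => (d n)%:R * Num.sqrt (k n)%:R
            * (1 + Delta n / Num.sqrt (n%:R / (k n)%:R))) =o_\oo C.

Lemma chernoff_large (M : R) :
  \forall n \near \oo, M * ((d n)%:R * Num.sqrt (k n)%:R) <= C n.
Proof.
pose e := (`|M| + 1)^-1.
have e0 : 0 < e by rewrite invr_gt0 ltr_wpDl.
have /eqoP/(_ e e0) := C_large; apply: filterS => n.
rewrite (ger0_norm (C0 n)); set s := Num.sqrt _; set r := _ / Num.sqrt _ => H.
have ds0 : 0 <= (d n)%:R * s by rewrite mulr_ge0 ?sqrtr_ge0.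
have r0 : 0 <= r by rewrite divr_ge0 ?sqrtr_ge0.
apply: (@le_trans _ _ ((`|M| + 1) * ((d n)%:R * s))).
  by apply: ler_wpM2r => //; apply: le_trans (ler_norm M) _; rewrite lerDl.
rewrite -ler_pdivlMl ?ltr_wpDl// -/e; apply: le_trans H.
apply: le_trans (ler_norm _); rewrite mulrDr mulr1 lerDl.
exact: mulr_ge0.
Qed.

Let sqrt_k_ge1 n : 1 <= Num.sqrt (k n)%:R :> R.
Proof. by rewrite -[leLHS]sqrtr1 ler_sqrt// ler1n (leq_trans _ (hk n)). Qed.

Let d_ge1 n : 1 <= (d n)%:R :> R.
Proof. by rewrite ler1n. Qed.

(** As [C] dominates [d * sqrt k] with [d, k >= 1], it dominates each of [d],
[sqrt k] and any constant. *)
Lemma chernoff_unbounded (M : R) :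
  \forall n \near \oo, [/\ M <= C n, (d n)%:R <= C n & (k n)%:R <= C n ^+ 2].
Proof.
apply: filterS (chernoff_large (`|M| + 1)) => n H.
have hs := sqrt_k_ge1 n; have h1 := d_ge1 n.
have ks : (k n)%:R = Num.sqrt (k n)%:R ^+ 2 :> R by rewrite sqr_sqrtr.
have M0 := normr_ge0 M; have M1 := ler_norm M.
have ds : Num.sqrt (k n)%:R <= (d n)%:R * Num.sqrt (k n)%:R :> R.
  by rewrite -[leLHS]mul1r ler_wpM2r// sqrtr_ge0.
have dd : (d n)%:R <= (d n)%:R * Num.sqrt (k n)%:R :> R.
  by rewrite -[leLHS]mulr1 ler_wpM2l.
rewrite ks; move: (Num.sqrt _) hs ds dd H => s hs ds dd H.
have sC : s <= C n by nra.
split; [by nra|by nra|].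
by rewrite lerXn2r ?nnegrE//; lra.
Qed.

(** Here the upper bound on the divergence in terms of the separation is used
backwards. *)
Lemma separation_large (M : R) :
  \forall n \near \oo, M <= Delta n /\ (k n)%:R <= Delta n ^+ 2.
Proof.
have sm := smin0; have hL := L0.
apply: filterS (chernoff_large ((`|M| + 1) / smin + L)) => n H.
have hs := sqrt_k_ge1 n; have d1 := d_ge1 n.
have ks : (k n)%:R = Num.sqrt (k n)%:R ^+ 2 :> R by rewrite sqr_sqrtr.
have M0 := normr_ge0 M; have M1 := ler_norm M.
rewrite ks; move: (Num.sqrt _) hs H => s hs H.
have := le_trans H (C_le n); rewrite mulrCA ler_pM2l ?(lt_le_trans ltr01)// => H2.
have H3 : (`|M| + 1) / smin * s <= Delta n / smin by nra.
have H4 : (`|M| + 1) * s <= Delta n by move: H3; rewrite mulrAC ler_pM2r ?invr_gt0.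
have sD : s <= Delta n by nra.
split; first by nra.
by rewrite lerXn2r ?nnegrE//; lra.
Qed.

Lemma separation_le_chernoff : exists2 K : R, 0 < K &
  \forall n \near \oo, (d n)%:R * Delta n <= K * C n.
Proof.
have /eqO_exP[K K0 H] := Delta_small; exists K => //.
apply: filterS H => n; rewrite (ger0_norm (Delta0 n)) normrM (ger0_norm (C0 n)).
have d0 : 0 < (d n)%:R :> R by rewrite ltr0n.
rewrite ger0_norm ?invr_ge0 ?(ltW d0)// => H.
by rewrite -ler_pdivlMl// mulrCA.
Qed.

(** Since [ln (d * k) >= ln 2], the square of the logarithm in the hypothesis
absorbs the constant [B] as well. *)
Lemma log_dimension_negligible (c B : R) : 0 < c ->
  \forall n \near \oo, ln (d n * k n)%:R + B <= c * (n%:R / (k n)%:R).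
Proof.
move=> c0; have l2 : 0 < ln 2 :> R by rewrite ln_gt0// ltr1n.
pose e := c * ln 2 / (1 + `|B| / ln 2).
have b0 : 0 < 1 + `|B| / ln 2 by rewrite ltr_wpDr// divr_ge0// ltW.
have e0 : 0 < e by rewrite divr_gt0// mulr_gt0.
have /eqoP/(_ e e0) := k_small; apply: filterS => n.
set l := ln _; rewrite ger0_norm; last by rewrite mulr_ge0// sqr_ge0.
rewrite normr_nat => H.
have ll : ln 2 <= l.
  have dk : (2 <= d n * k n)%N by rewrite (leq_trans (hk n))// leq_pmull.
  by rewrite ler_ln ?posrE ?ltr0n ?ler_nat// (leq_trans _ dk).
have k0 : 0 < (k n)%:R :> R by rewrite ltr0n (leq_trans _ (hk n)).
have H1 : l ^+ 2 * (1 + `|B| / ln 2) <= c * ln 2 * (n%:R / (k n)%:R).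
  rewrite mulrA ler_pdivlMr//; move: H; rewrite /e mulrAC ler_pdivlMr//.
  by move=> H; lra.
have l0 : 0 < l by exact: lt_le_trans ll.
have lB : l + B <= l * (1 + `|B| / ln 2).
  rewrite mulrDr mulr1 lerD2l; apply: le_trans (ler_norm B) _.
  by rewrite mulrA ler_pdivlMr// mulrC ler_wpM2r.
apply: le_trans lB _; rewrite -(ler_pM2l l2).
apply: le_trans (_ : _ <= l ^+ 2 * (1 + `|B| / ln 2)) _.
  by rewrite expr2 -mulrA ler_wpM2r// mulr_ge0 ?(ltW l0) ?(ltW b0).
by rewrite mulrA (mulrC (ln 2)).
Qed.

(** With [k <= C ^ 2] and [Delta <= K * C], the ratio of the two sides is at most
[C ^ 3 * exp (- C / 2)] up to a constant. *)
Lemma contraction_rate (eta rho : R) : 0 < eta -> 0 < rho -> rho <= 8^-1 ->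
  \forall n \near \oo,
    n%:R * expR (- ((1 - 4 * rho) * C n)) * Delta n <= eta * (n%:R / (k n)%:R).
Proof.
move=> eta0 rho0 rho8; have [K K0 KC] := separation_le_chernoff.
have half0 : 0 < 2^-1 :> R by rewrite invr_gt0.
have [x0 x0P] := exp_beats_power 3 half0 (divr_gt0 eta0 K0).
apply: filterS2 KC (chernoff_unbounded x0) => n KC [Cx _ kC].
have k0 : 0 < (k n)%:R :> R by rewrite ltr0n (leq_trans _ (hk n)).
rewrite -mulrA [leRHS]mulrCA ler_wpM2l// ler_pdivlMr//.
have DK : Delta n <= K * C n.
  by apply: le_trans KC; rewrite -[leLHS]mul1r ler_wpM2r.
have eC : expR (- ((1 - 4 * rho) * C n)) <= expR (- (2^-1 * C n)).
  by rewrite ler_expR lerN2 ler_wpM2r//; lra.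
have := x0P _ Cx; rewrite ler_pdivlMr// => H; apply: le_trans H.
rewrite (_ : _ * expR _ * K = expR (- (2^-1 * C n)) * (K * C n) * C n ^+ 2); last first.
  by rewrite !exprS; ring.
by rewrite !ler_pM ?mulr_ge0 ?expR_ge0.
Qed.

(** Up to a constant, the first two terms are at most [d * k] times a decreasing
exponential in [nu], and [nu] dominates [ln (d * k)]; the exponent [n * exp (-
Delta / 2)] is absorbed using [k <= Delta ^ 2]. The last ones are powers of [C]
times exponentials in [- C]. *)
Lemma failure_bound_vanishes (alpha eta rho b : R) : 0 < alpha -> 0 < eta ->
  0 < rho -> 0 < b ->
  \forall n \near \oo, failure_bound n (d n) (k n) alpha eta (Delta n)
     (n%:R / (k n)%:R) (C n) rho <= b.
Proof.
move=> alpha0 eta0 rho0 b0.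
have c1 : 0 < alpha * (eta ^+ 2 / 8) by rewrite mulr_gt0// divr_gt0// exprn_gt0.
have c2 : 0 < eta / 4 by rewrite divr_gt0.
have half0 : 0 < 2^-1 :> R by rewrite invr_gt0.
have e8 : 0 < eta / 8 by rewrite divr_gt0.
have [x1 x1P] := exp_beats_power 2 half0 e8.
have r4 : 0 < 4 * rho by rewrite mulr_gt0.
have r3 : 0 < 3 * rho by rewrite mulr_gt0.
have b4 : 0 < b / 4 by rewrite divr_gt0.
have be4 : 0 < b / 4 / expR 1 by rewrite divr_gt0// expR_gt0.
have [x2 x2P] := exp_beats_power 0 r4 b4.
have [x3 x3P] := exp_beats_power 2 r3 be4.
near=> n.
have k0 : 0 < (k n)%:R :> R by rewrite ltr0n (leq_trans _ (hk n)).
have dk0 : 0 < (d n * k n)%:R :> R.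
  by rewrite ltr0n muln_gt0 hd (leq_trans _ (hk n)).
set nu := n%:R / (k n)%:R.
have nE : n%:R = (k n)%:R * nu by rewrite /nu mulrC divfK// gt_eqF.
have nu0 : 0 <= nu by rewrite divr_ge0.
have [Cx2 _ kC] : [/\ x2 <= C n, (d n)%:R <= C n & (k n)%:R <= C n ^+ 2].
  by near: n; exact: chernoff_unbounded.
have [Cx3 _ _] : [/\ x3 <= C n, (d n)%:R <= C n & (k n)%:R <= C n ^+ 2].
  by near: n; exact: chernoff_unbounded.
have [Dx1 kD] : x1 <= Delta n /\ (k n)%:R <= Delta n ^+ 2.
  by near: n; exact: separation_large.
have log1 : ln (d n * k n)%:R - ln (b / 16) <= alpha * (eta ^+ 2 / 8) * nu.
  by rewrite /nu; near: n; exact: log_dimension_negligible.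
have log2 : ln (d n * k n)%:R - ln (b / 4) <= eta / 4 * nu.
  by rewrite /nu; near: n; exact: log_dimension_negligible.
have small (x e : R) : 0 < e -> ln (d n * k n)%:R - ln e <= x ->
    (d n * k n)%:R * expR (- x) <= e.
  move=> ee H; rewrite -{1}(lnK (dk0 : _ \is Num.pos)) -expRD.
  rewrite -[leRHS](lnK (ee : _ \is Num.pos)).
  by rewrite ler_expR; lra.
have F1 : (4 * (d n * k n))%:R * expR (- (alpha * nu * eta ^+ 2 / 8)) <= b / 4.
  have := small _ _ _ log1; rewrite divr_gt0// => /(_ isT) H.
  rewrite natrM -mulrA.
  rewrite (_ : alpha * nu * eta ^+ 2 / 8 = alpha * (eta ^+ 2 / 8) * nu); last by ring.
  by lra.
have F2 : (d n)%:R * expR (n%:R * (2 * expR (- (2^-1 * Delta n))) -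
    2^-1 * (eta * nu)) <= b / 4.
  apply: le_trans (small _ _ b4 log2).
  apply: ler_pM; rewrite ?expR_ge0//.
    by rewrite ler_nat leq_pmulr// (leq_trans _ (hk n)).
  rewrite ler_expR.
  have H : (k n)%:R * expR (- (2^-1 * Delta n)) <= eta / 8.
    by apply: le_trans (x1P _ Dx1); rewrite ler_wpM2r ?expR_ge0.
  have := ler_wpM2r nu0 H; rewrite nE.
  by move: (expR _) => E; lra.
have F3 : expR (- (4 * rho * C n)) <= b / 4.
  by have := x2P _ Cx2; rewrite expr0 mul1r.
have F4 : (k n)%:R * expR (1 - 3 * rho * C n) <= b / 4.
  have := x3P _ Cx3; rewrite ler_pdivlMr ?expR_gt0//; apply: le_trans.
  by rewrite addrC expRD mulrA ler_wpM2r ?expR_ge0// ler_wpM2r ?expR_ge0.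
rewrite /failure_bound -/nu; lra.
Unshelve. all: by end_near. Qed.

End regime.

(** * Recovery with high probability *)

(** For the finitely many exceptional [n] the empty event is used. *)
Lemma with_high_probability_le (R : realType) (disp : nat -> measure_display)
    (T : forall n, measurableType (disp n)) (P : forall n, probability (T n) R)
    (Q : forall n, set (T n)) (s : nat -> R) : s n @[n --> \oo] --> 0 ->
  (\forall n \near \oo, exists E : set (T n),
    [/\ measurable E, E `<=` Q n & ((1 - s n)%:E <= P n E)%E]) ->
  with_high_probability P Q.
Proof.
move=> s0 H.
have W n : {E : set (T n) | [/\ measurable E, E `<=` Q n &
    (exists E' : set (T n),
      [/\ measurable E', E' `<=` Q n & ((1 - s n)%:E <= P n E')%E]) ->
    ((1 - s n)%:E <= P n E)%E]}.
  apply: cid; have [[E [mE EQ PE]]|no] := pselect (exists E' : set (T n),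
      [/\ measurable E', E' `<=` Q n & ((1 - s n)%:E <= P n E')%E]).
    by exists E.
  by exists set0; split => // /no.
exists (fun n => sval (W n)); split.
- by move=> n; case: (svalP (W n)).
- by move=> n; case: (svalP (W n)).
apply: (@squeeze_cvge _ _ _ _ (fun n => (1 - s n)%:E) _ (fun=> 1%:E)).
- apply: filterS H => n Hn; case: (svalP (W n)) => mE _ /(_ Hn) ->.
  exact: probability_le1.
- apply: cvg_EFin; first exact: nearW.
  rewrite -[X in _ --> X]subr0; apply: cvgB => //; exact: cvg_cst.
- exact: cvg_cst.
Qed.

Theorem theorem5 (R : realType)
    (k d : nat -> nat)
    (hk : forall n, (2 <= k n)%N) (hd : forall n, (1 <= d n)%N)
    (zs : forall n, {ffun 'I_n -> 'I_(k n)})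
    (mu : forall n, 'I_(k n) -> 'I_(d n) -> R)
    (sigma : nat -> nat -> R)
    (smin smax : R) (hsmin : 0 < smin)
    (hsigma : forall n (a : 'I_(k n)) (l : 'I_(d n)),
       smin <= sigma a l <= smax)
    (disp : nat -> measure_display)
    (Omega : forall n, measurableType (disp n))
    (P : forall n, probability (Omega n) R)
    (eps : forall n, 'I_n * 'I_(d n) -> {RV (P n) >-> R})
    (heps_indep : forall n, mutually_independent (eps n))
    (heps_lap : forall n il, has_density (eps n il) (laplace_pdf 0 1))
    (X : forall n, Omega n -> 'I_n -> 'I_(d n) -> R)
    (hX : forall n w i l,
       X n w i l = mu n (zs n i) l + sigma (zs n i) l * eps n (i, l) w)
    (alpha : R) (halpha : 0 < alpha)
    (zhat : forall n, Omega n -> nat -> {ffun 'I_n -> 'I_(k n)}) :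
  let f n (a : 'I_(k n)) := laplace_density (mu n a) (fun l => sigma a l) in
  let C n : R := fine (chernoff_family (f n)) in
  let Delta n : R := separation_inf (mu n) in
  (fun n => (k n)%:R * ln (d n * k n)%:R ^+ 2) =o_\oo (fun n => n%:R : R) ->
  (\forall n \near \oo, forall a : 'I_(k n),
     alpha * n%:R / (k n)%:R <= #|label_class (zs n) a|%:R) ->
  Delta =O_\oo (fun n => (d n)%:R^-1 * C n) ->
  (fun n => (d n)%:R * Num.sqrt (k n)%:R
            * (1 + Delta n / Num.sqrt (n%:R / (k n)%:R))) =o_\oo C ->
  (forall n w, iterates (X n w) (zhat n w)) ->
  (exists delta : nat -> R, delta n @[n --> \oo] --> 0 /\
     with_high_probability P (fun n => [set w |
       (loss (zs n) (zhat n w 0%N))%:R * ((k n)%:R * Delta n) <= delta n * n%:R])) ->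
  forall c : R, 0 < c ->
  exists e : nat -> R, e n @[n --> \oo] --> 0 /\
    with_high_probability P (fun n => [set w | forall t : nat,
       Num.floor (c * ln n%:R) <= t%:Z ->
       n%:R^-1 * (loss (zs n) (zhat n w t))%:R <= expR (- ((1 + e n) * C n))]).
Proof.
move=> f C Delta k_small classes Delta_small C_large it
  [delta [delta0 [E0 [mE0 E0Q PE0]]]] c c0.
pose sg n (a : 'I_(k n)) (l : 'I_(d n)) : R := sigma a l.
have family n := chernoff_family_laplace (mu n) (hk n) hsmin (hsigma n).
have C_ge0 n : 0 <= C n by have [] := family n.
have C_le n : C n <= (d n)%:R * (Delta n / smin + ln (smax / smin)).
  by have [] := family n.
have C_chernoff n a b : b != a -> ((C n)%:E <= Defs.chernoff
    (laplace_density (mu n b) (sg n b)) (laplace_density (mu n a) (sg n a)))%E.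
  by have [_ _ H] := family n; exact: H.
have Delta_ge0 n : 0 <= Delta n by exact: separation_inf_ge0.
have smin_max : smin <= smax.
  have /andP[] := hsigma 0%N (Ordinal (ltnW (hk 0%N))) (Ordinal (hd 0%N)).
  exact: le_trans.
have smax0 : 0 < smax by exact: lt_le_trans smin_max.
have L0 : 0 <= ln (smax / smin).
  by rewrite ln_ge0// ler_pdivlMr// mul1r.
pose Q n (r : R) := [set w | forall t : nat, Num.floor (c * ln n%:R) <= t%:Z ->
  n%:R^-1 * (loss (zs n) (zhat n w t))%:R <= expR (- ((1 - r) * C n))].
pose A n (r : R) := exists E : set (Omega n),
  [/\ measurable E, E `<=` Q n r & ((1 - r)%:E <= P n E)%E].
have A_mono n r r' : r <= r' -> A n r -> A n r'.
  move=> rr' [E [mE EQ PE]]; exists E; split => //.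
    move=> w Ew t ht; apply: le_trans (EQ w Ew t ht) _.
    by rewrite ler_expR lerN2 ler_wpM2r//; lra.
  by apply: le_trans PE; rewrite lee_fin; lra.
suff A_near r : 0 < r -> \forall n \near \oo, A n r.
  have [s [s0 As]] := vanishing_precision A_mono A_near.
  exists (fun n => - s n); split; first by rewrite -oppr0; exact: cvgN.
  exact: with_high_probability_le s0 As.
(* For [r <= 1/2] the exponent [(1 - r) * C] is at least [C / 2]. *)
wlog r_half : r / r <= 2^-1.
  move=> H r0; have [rh|rh] := leP r 2^-1; first exact: H.
  apply: filterS (H 2^-1 (lexx _) _) => [n|]; last by rewrite invr_gt0.
  by apply: A_mono; exact: ltW.
move=> r0; pose rho := r / 4.
have rho0 : 0 < rho by rewrite divr_gt0.
have rho8 : rho <= 8^-1 by rewrite /rho; lra.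
have [K K0 KC] := separation_le_chernoff hd C_ge0 Delta_ge0 Delta_small.
pose K1 := estimation_const smax alpha; pose K2 := score_const smin smax.
have K10 : 0 < K1.
  by rewrite addr_gt0 ?divr_gt0 ?mulr_gt0 ?addr_gt0 ?mulr_gt0.
have K20 : 0 < K2.
  have i2 : 0 < 2 / smin ^+ 2 by rewrite divr_gt0// exprn_gt0.
  by rewrite /K2 /score_const !addr_gt0 ?divr_gt0// mulr_gt0.
have [eta [eta01 eta_alpha eta_small eta_slack]] : exists eta : R,
    [/\ 0 < eta <= 1, eta <= alpha / 2, 2 * eta * K1 <= smin / 2 &
        4 * eta * K1 * K2 * (K + 4) <= rho].
  have a2 : 0 < alpha / 2 by rewrite divr_gt0.
  have k1 : 0 < 4 * K1 by rewrite mulr_gt0.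
  have k2 : 0 < 4 * K1 * K2 * (K + 4) by rewrite !mulr_gt0// addr_gt0.
  have b2 : 0 < smin / (4 * K1) by rewrite divr_gt0.
  have c2 : 0 < rho / (4 * K1 * K2 * (K + 4)) by rewrite divr_gt0.
  exists (Num.min (Num.min 1 (alpha / 2))
    (Num.min (smin / (4 * K1)) (rho / (4 * K1 * K2 * (K + 4))))).
  set eta := Num.min _ _.
  have : eta <= Num.min 1 (alpha / 2) by rewrite ge_min lexx.
  rewrite le_min => /andP[e1 e2].
  have : eta <= Num.min (smin / (4 * K1)) (rho / (4 * K1 * K2 * (K + 4))).
    by rewrite ge_min lexx orbT.
  rewrite le_min => /andP[h3 h4].
  have e3 : eta * (4 * K1) <= smin by rewrite -ler_pdivlMr.
  have e4 : eta * (4 * K1 * K2 * (K + 4)) <= rho by rewrite -ler_pdivlMr.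
  split; [|exact: e2|lra|by move: e4; rewrite !mulrA (mulrC eta)].
  by rewrite e1 andbT !lt_min ltr01 a2 b2 c2.
have /andP[eta0 _] := eta01.
have r2 : 0 < r / 2 by rewrite divr_gt0.
have PE0_near : \forall n \near \oo, ((1 - r / 2)%:E <= P n (E0 n))%E.
  have /fine_cvgP[_ /cvgr_ge] := PE0.
  move=> /(_ (1 - r / 2) _)/[!ltrBlDr]/[!ltrDl]/(_ r2); apply: filterS => n.
  by rewrite -lee_fin /= fineK// fin_num_measure.
near=> n.
have n0 : (0 < n)%N by near: n; exact: nbhs_infty_gt.
have k0 : 0 < (k n)%:R :> R by rewrite ltr0n (leq_trans _ (hk n)).
have nR0 : 0 < n%:R :> R by rewrite ltr0n.
have nu0 : 0 < n%:R / (k n)%:R :> R by rewrite divr_gt0.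
have class_large a : alpha * (n%:R / (k n)%:R) <= #|label_class (zs n) a|%:R.
  by rewrite mulrA; move: a; near: n.
have [_ dC _] : [/\ 0 <= C n, (d n)%:R <= C n & (k n)%:R <= C n ^+ 2].
  by near: n; exact: (chernoff_unbounded hk hd C_ge0 Delta_ge0 C_large).
have [D1 _] : 1 <= Delta n /\ (k n)%:R <= Delta n ^+ 2.
  by near: n; exact: (separation_large hk hd hsmin L0 C_ge0 Delta_ge0 C_le C_large).
have dDC : (d n)%:R * Delta n <= K * C n by near: n.
have rate : n%:R * expR (- ((1 - 4 * rho) * C n)) * Delta n <= eta * (n%:R / (k n)%:R).
  near: n.
  exact: (contraction_rate hk hd C_ge0 Delta_ge0 Delta_small C_large).
have fail : failure_bound n (d n) (k n) alpha eta (Delta n)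
    (n%:R / (k n)%:R) (C n) rho <= r / 2.
  near: n.
  exact: (failure_bound_vanishes hk hd hsmin L0 C_ge0 Delta_ge0 C_le k_small C_large).
have PE0n : ((1 - r / 2)%:E <= P n (E0 n))%E.
  by near: n.
have delta_eta : delta n <= eta by near: n; exact: (cvgr_le _ delta0).
have start : 1 <= c * ln n%:R.
  rewrite -ler_pdivrMl// mulr1 -ler_expR lnK ?posrE//.
  by near: n; exact: nbhs_infty_ger.
have slack : 4 * eta * K1 * K2 * ((d n)%:R * Delta n + 4 * C n) <= rho * C n.
  apply: le_trans (ler_wpM2r (C_ge0 n) eta_slack); rewrite -[leRHS]mulrA.
  have c4 : 0 <= 4 * eta * K1 * K2.
    by rewrite !mulr_ge0// ltW.
  by apply: (ler_wpM2l c4); rewrite (mulrDl K 4) lerD2r.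
have [E [mE PE HE]] := recovery_event (heps_indep n) (heps_lap n) (hX n) n0 hsmin
  smin_max halpha eta01 nu0 D1 (ltW rho0) dC (hsigma n)
  (@separation_infP _ _ _ (mu n)) class_large (C_chernoff n) eta_alpha eta_small
  slack rate.
exists (E0 n `&` E); split.
- exact: measurableI.
- move=> w [E0w Ew] t ht.
  have t0 : (0 < t)%N.
    have : 1%:Z <= Num.floor (c * ln n%:R) by rewrite floor_ge_int.
    by move=> h1; have := le_trans h1 ht.
  have init : (loss (zs n) (zhat n w 0%N))%:R * Delta n <= eta * (n%:R / (k n)%:R).
    have := E0Q n w E0w; rewrite /= => h; rewrite mulrA ler_pdivlMr//.
    rewrite -mulrA (mulrC (Delta n)); apply: le_trans h _.
    by rewrite ler_wpM2r.
  rewrite mulrC ler_pdivrMr// mulrC.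
  have := HE w Ew (zhat n w) (it n w) init t t0.
  by rewrite (_ : 1 - 4 * rho = 1 - r)// /rho; lra.
- rewrite (splitr r); apply: probability_setI_ge => //.
  by apply: le_trans PE; rewrite lee_fin; lra.
Unshelve. all: by end_near. Qed.
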